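(* Let $P$ be an open integer polygon in $\mathbb{R}^2$ and let $g$ be a smooth function on $\mathbb{R}^2$. Then there exists a constant $C$ (independent of $N$) such that for every positive integer $N$, $$\left|\int_{P}g(x)\,dx-\left(\frac{1}{N^{2}}\sum_{n\in\mathbb{Z}^2,\ N^{-1}n\in P}g(N^{-1}n)+\frac{1}{2N^{2}}\sum_{n\in\mathbb{Z}^2,\ N^{-1}n\in\partial P}g(N^{-1}n)\right)\right|\leq\frac{C}{N^{2}}.$$
   Context: An integer polygon is a polygon in $\mathbb{R}^2$ all of whose vertices have integer coordinates; ''open'' means that the boundary $\partial P$ is not included in $P$. *)

(* Defs.v *)
(* MathComp-Analysis, over an arbitrary R : realType; the plane is R * R. *)
From HB Require Import structures.
From mathcomp Require Import all_boot all_order all_algebra.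
From mathcomp Require Import all_classical all_reals all_analysis.

Set Implicit Arguments.
Unset Strict Implicit.
Unset Printing Implicit Defensive.

Import Order.TTheory GRing.Theory Num.Theory.
Import numFieldNormedType.Exports.

Local Open Scope classical_set_scope.
Local Open Scope ring_scope.

Definition frontier (T : topologicalType) (A : set T) : set T :=
  closure A `\` A°.

Section Polygon.
Variable R : realType.
Implicit Types (P : set (R * R)) (cs : seq (seq (R * R))).

Definition plane_segment (e : (R * R) * (R * R)) : set (R * R) :=
  [set (line_path e.1.1 e.2.1 t, line_path e.1.2 e.2.2 t) | t in `[0, 1]].

(* The edges of the closed polygonal chain v_0, ..., v_k, v_0. *)
Definition chain_edges (c : seq (R * R)) : seq ((R * R) * (R * R)) :=
  zip c (rot 1 c).

Definition edges cs : seq ((R * R) * (R * R)) :=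
  flatten [seq chain_edges c | c <- cs].

(* [P] is the open region bounded by the closed polygonal chains [cs], none of
   whose edges cross or overlap.  A simple polygon, i.e., the bounded component
   of the complement of a simple closed chain, is the case of a single chain;
   further chains describe holes.  Since each edge is used once by a closed chain
   and P is connected, no edge is a slit with P on both sides. *)
Definition open_polygon cs P : Prop :=
  [/\ uniq (edges cs),
      (forall e, e \in edges cs -> e.1 != e.2) &
      (forall e f, e \in edges cs -> f \in edges cs -> e != f ->
         plane_segment e `&` plane_segment f `<=` [set e.1; e.2])] /\
  [/\ P !=set0, open P, connected P, bounded_set P &
      frontier P = \bigcup_(e in [set` edges cs]) plane_segment e].

Definition integer_point (v : R * R) : Prop :=
  v.1 \is a Num.int /\ v.2 \is a Num.int.

Definition open_integer_polygon P : Prop :=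
  exists cs, open_polygon cs P /\
    forall c v, c \in cs -> v \in c -> integer_point v.

Fixpoint continuously_differentiable (k : nat) (g : R * R -> R) : Prop :=
  if k is k'.+1 then
    [/\ continuous g,
        (forall x, derivable g x (1, 0) /\ derivable g x (0, 1)),
        continuously_differentiable k' ('D_(1, 0) g) &
        continuously_differentiable k' ('D_(0, 1) g)]
  else continuous g.

Definition smooth (g : R * R -> R) : Prop :=
  forall k, continuously_differentiable k g.

Definition scaled_point (N : nat) (n : int * int) : R * R :=
  (N%:R^-1 * n.1%:~R, N%:R^-1 * n.2%:~R).

End Polygon.

Arguments scaled_point {R} N n.

(* Main.v *)
Require Import Defs.
From HB Require Import structures.
From mathcomp Require Import all_boot all_order all_algebra.
From mathcomp Require Import all_classical all_reals all_analysis.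
From mathcomp Require Import measurable_realfun.
From mathcomp Require Import ring lra zify.

Set Implicit Arguments.
Unset Strict Implicit.
Unset Printing Implicit Defensive.

Import Order.TTheory GRing.Theory Num.Theory.
Import numFieldNormedType.Exports.

Local Open Scope classical_set_scope.
Local Open Scope ring_scope.

(** For a function [u] of bounded support let the defect D_N(u) be the integral
    of [u] minus N^-2 times the sum of [u] over the lattice (1/N)Z^2
    ([defect]).  With w = 1 on P, 1/2 on the boundary and 0 elsewhere
    ([half_weight]), the claim is that D_N(w g) = O(N^-2).  D_N is linear, and
    the point reflections about half-lattice points preserve both the Lebesgue
    measure and the lattice, so D_N vanishes on functions that are odd about
    such a point ([defect_odd]).

    Geometry.  Off the vertices, w is a linear combination, over the edges, of
    signed trapezoid weights: an edge carries the function of (x, y) that is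
    supported on the x-range of the edge and there is the sign of the vertical
    position relative to the edge, with averaged values at the discontinuities
    ([half_weight_decomposition]).  What makes this work is that P lies on
    exactly one side of each edge, and on the same side all along it.  The
    winding number of the chains explains this: it is locally constant off the
    boundary, hence constant on the connected set P, whereas it jumps by one
    across an edge, because each edge is used once ([edge_sign]).  On a vertical
    line that avoids the vertices, the difference between w and the combination
    of trapezoid weights is then constant, with opposite values far up and far
    down, so it is zero; averaging from both sides gives the other lines.

    Estimates.  The trapezoid of an edge with integral endpoints and x-extent q
    is cut into N columns of width q/N ([edge_estimate_lr]).  The end points of
    the columns on the edge are lattice points of (1/N)Z^2.  So each column is
    made of rectangles with lattice corners and of a piece around the edge,
    which is odd about the midpoint of a lattice segment ([edge_diagonal]).
    - A lattice cell has D_N = 0, and so has its product with a linear function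
      about its centre, by oddness; with g replaced by its Taylor remainder the
      cell contributes O(N^-4) ([cell_estimate]).  There are O(N^2) cells.
    - The piece around the edge has D_N = 0 by oddness; with g replaced by its
      variation on the piece it contributes O(N^-3)
      ([edge_diagonal_estimate]).  There are N pieces.
    The vertices, where the decomposition of w fails, are finitely many lattice
    points, of weight N^-2 each ([defect_point]). *)

(** * Edges and locally constant functions *)

Section LocallyConstant.
Variables (T : topologicalType) (U : Type).

Lemma locally_constant_connected (A : set T) (f : T -> U) : connected A ->
  (forall x, A x -> \forall y \near x, A y -> f y = f x) ->
  forall x y, A x -> A y -> f x = f y.
Proof.
move=> cA lf x y Ax Ay; pose B := A `&` [set z | f z = f x].
suff BA : B = A by have [_ ->] : B y by rewrite BA.
apply: cA.
- by exists x.
- exists ([set z | A z -> f z = f x]°); first exact: open_interior.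
  apply/seteqP; split => z [Az zx]; split => //.
    by apply: filterS (lf z Az) => t zt At; rewrite zt.
  exact: (interior_subset zx).
- exists (~` [set z | A z -> f z <> f x]°); first exact/open_closedC/open_interior.
  apply/seteqP; split => z [Az zx]; split => //.
    by move=> /interior_subset /(_ Az).
  apply: contrapT => zx'; apply: zx; apply: filterS (lf z Az) => t zt At.
  by rewrite zt.
Qed.

End LocallyConstant.

Section Edges.
Variable R : realType.
Implicit Types (e f : (R * R) * (R * R)) (z t u v : R * R).

Lemma nbhs_plane_box (z : R * R) (A : set (R * R)) : nbhs z A ->
  exists2 e : R, 0 < e &
    forall t : R * R, `|t.1 - z.1| < e -> `|t.2 - z.2| < e -> A t.
Proof.
move=> /nbhs_ballP[e /= e0 eA]; exists e => // t t1 t2; apply: eA.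
by split; rewrite /ball /= distrC.
Qed.

Lemma near_all (I : eqType) (s : seq I) z (Q : I -> R * R -> Prop) :
  (forall i, i \in s -> \forall t \near z, Q i t) ->
  \forall t \near z, forall i, i \in s -> Q i t.
Proof.
elim: s => [|i s IHs] H; first exact: filterE.
have /IHs H' : forall j, j \in s -> \forall t \near z, Q j t.
  by move=> j js; apply: H; rewrite inE js orbT.
apply: filterS2 H' (H i (mem_head _ _)) => t ts ti j.
by rewrite inE => /predU1P[->|/ts].
Qed.

(** The sign functions below jump only on lines, so at a given point most of
    them are constant nearby; this is the form in which continuity is used. *)
Lemma near_sgr (g : R * R -> R) z : {for z, continuous g} -> g z != 0 ->
  \forall t \near z, Num.sg (g t) = Num.sg (g z).
Proof.
move=> cg; rewrite neq_lt => /orP[gz|gz].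
  by apply: filterS (cvgr_lt _ cg _ gz) => t gt; rewrite !ltr0_sg.
by apply: filterS (cvgr_gt _ cg _ gz) => t gt; rewrite !gtr0_sg.
Qed.

(** The signed indicator of the interval from [a] to [b], with value 1/2 at the
    end points and negated when [b < a].  With this convention it is additive in
    its end points at every [x], exactly and not just almost everywhere, so
    subdivisions are valid for lattice sums too. *)
Definition step (a b x : R) : R := (Num.sg (x - a) - Num.sg (x - b)) / 2.

(** Positive on the left of the oriented line through the edge. *)
Definition edge_det e z : R :=
  (e.2.1 - e.1.1) * (z.2 - e.1.2) - (e.2.2 - e.1.2) * (z.1 - e.1.1).

(** On the line through the edge, nonnegative exactly between the end points.
    Together with [edge_det] it describes the edge by sign conditions that treat
    vertical edges like the others. *)
Definition edge_dot e z : R :=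
  (z.1 - e.1.1) * (e.2.1 - z.1) + (z.2 - e.1.2) * (e.2.2 - z.2).

(** For an edge that is not vertical, the sign of the height of [z] above the
    edge, whatever the orientation of the edge. *)
Definition side e z : R := Num.sg (e.2.1 - e.1.1) * Num.sg (edge_det e z).

Definition inside e z := (edge_det e z == 0) && (0 < edge_dot e z).

Lemma continuous_fst : continuous (fst : R * R -> R).
Proof. by move=> z; exact: cvg_fst. Qed.

Lemma continuous_snd : continuous (snd : R * R -> R).
Proof. by move=> z; exact: cvg_snd. Qed.

Lemma continuous_edge_det e : continuous (edge_det e).
Proof.
move=> z; apply: cvgB; apply: cvgM; try exact: cvg_cst.
- by apply: cvgB; [exact: continuous_snd|exact: cvg_cst].
- by apply: cvgB; [exact: continuous_fst|exact: cvg_cst].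
Qed.

Lemma continuous_edge_dot e : continuous (edge_dot e).
Proof.
move=> z; apply: cvgD; apply: cvgM.
- by apply: cvgB; [exact: continuous_fst|exact: cvg_cst].
- by apply: cvgB; [exact: cvg_cst|exact: continuous_fst].
- by apply: cvgB; [exact: continuous_snd|exact: cvg_cst].
- by apply: cvgB; [exact: cvg_cst|exact: continuous_snd].
Qed.

Lemma edge_sqr_gt0 e : e.1 != e.2 ->
  0 < (e.2.1 - e.1.1) ^+ 2 + (e.2.2 - e.1.2) ^+ 2.
Proof.
case: e => [[a b] [c d]] /= ab.
rewrite lt_neqAle addr_ge0 ?sqr_ge0 // andbT eq_sym paddr_eq0 ?sqr_ge0 //.
rewrite !sqrf_eq0 !subr_eq0; apply: contraNN ab => /andP[/eqP -> /eqP ->].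
by [].
Qed.

Lemma edge_param e (t : R) : e.1 != e.2 -> let z :=
  (line_path e.1.1 e.2.1 t, line_path e.1.2 e.2.2 t) in
  edge_det e z = 0 /\ edge_dot e z = t * (1 - t) * ((e.2.1 - e.1.1) ^+ 2 + (e.2.2 - e.1.2)
    ^+ 2).
Proof.
case: e => [[a b] [c d]] /= _; rewrite /edge_det /edge_dot /line_path /=.
by split; ring.
Qed.

Lemma plane_segmentP e z : e.1 != e.2 ->
  plane_segment e z <-> edge_det e z = 0 /\ 0 <= edge_dot e z.
Proof.
move=> ne; have L0 := edge_sqr_gt0 ne; split.
  move=> [t + <-]; rewrite /= in_itv /= => /andP[t0 t1].
  have [-> ->] := edge_param t ne; split => //.
  by rewrite !mulr_ge0 ?subr_ge0 // ltW.
set L := _ + _ in L0 * => - [dz dot].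
(* The parameter of the orthogonal projection of [z] to the line. *)
pose p := ((z.1 - e.1.1) * (e.2.1 - e.1.1) + (z.2 - e.1.2) * (e.2.2 - e.1.2)) / L.
have zp : (line_path e.1.1 e.2.1 p, line_path e.1.2 e.2.2 p) = z.
  rewrite [RHS]surjective_pairing; congr (_, _); apply: (mulfI (lt0r_neq0 L0)).
    have -> : L * line_path e.1.1 e.2.1 p = L * z.1 + (e.2.2 - e.1.2) * edge_det e z.
      by rewrite /line_path /p /edge_det /L; field; rewrite gt_eqF.
    by rewrite dz mulr0 addr0.
  have -> : L * line_path e.1.2 e.2.2 p = L * z.2 - (e.2.1 - e.1.1) * edge_det e z.
    by rewrite /line_path /p /edge_det /L; field; rewrite gt_eqF.
  by rewrite dz mulr0 subr0.
exists p => //=; move: dot; have [_] := edge_param p ne; rewrite zp => ->.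
rewrite pmulr_lge0 // in_itv /= => pp.
have [p0|p0] := ltP p 0.
  by move: pp; rewrite nmulr_rge0 // => ?; exfalso; lra.
have [p1|//] := ltP 1 p.
by move: pp; rewrite pmulr_rge0; lra.
Qed.

Lemma insideP e z : e.1 != e.2 ->
  reflect [/\ plane_segment e z, z != e.1 & z != e.2] (inside e z).
Proof.
move=> ne; have L0 := edge_sqr_gt0 ne.
have dot1 : edge_dot e e.1 = 0 by rewrite /edge_dot; ring.
have dot2 : edge_dot e e.2 = 0 by rewrite /edge_dot; ring.
apply: (iffP andP) => [[/eqP dz dot]|[]].
  split; first by apply/plane_segmentP => //; split => //; exact: ltW.
    by apply/eqP => ze; move: dot; rewrite ze dot1 ltxx.
  by apply/eqP => ze; move: dot; rewrite ze dot2 ltxx.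
move=> [t + <-]; rewrite /= in_itv /= => /andP[t0 t1] z1 z2.
have [-> ->] := edge_param t ne; split => //.
have t0' : 0 < t.
  rewrite lt_neqAle t0 andbT; apply: contraNneq z1 => <-.
  by rewrite /line_path subr0 !mul1r !mul0r !addr0 -surjective_pairing.
have t1' : t < 1.
  rewrite lt_neqAle t1 andbT; apply: contraNneq z2 => ->.
  by rewrite /line_path subrr !mul1r !mul0r !add0r -surjective_pairing.
by rewrite !mulr_gt0 // subr_gt0.
Qed.

(** The contribution of an edge to twice the winding number around [z], with
    averaged values at the discontinuities. *)
Definition edge_wind e z : R := step e.1.1 e.2.1 z.1 * side e z.

(** The change that the vertex [v], above or below [z], causes when [t] leaves
    the vertical line of [z].  It is attached to a vertex with one sign for the
    edge that leaves it and the other for the edge that enters it, so it cancels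
    along a closed chain. *)
Definition vertex_jump z t v : R :=
  if v.1 == z.1 then Num.sg (t.1 - z.1) * Num.sg (z.2 - v.2) else 0.

(** All local information on an edge in one formula: a term that cancels along
    closed chains, and a jump for the edges through [z] only.  Vertical edges,
    for which [edge_wind] vanishes, fit in because their two vertex terms cancel
    the jump. *)
Lemma edge_wind_near e z : e.1 != e.2 -> z != e.1 -> z != e.2 ->
  \forall t \near z, edge_wind e t = edge_wind e z +
    (vertex_jump z t e.1 - vertex_jump z t e.2) / 2 +
    (inside e z)%:R * Num.sg (edge_det e t).
Proof.
move=> ne z1 z2.
have nearx (a : R) : \forall t \near z, a != z.1 -> Num.sg (t.1 - a) = Num.sg (z.1 - a).
  have [->|az] := eqVneq a z.1; first exact: filterE.
  apply: filterS (@near_sgr (fun t => t.1 - a) z _ _) => [t //||].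
    by apply: cvgB; [exact: continuous_fst|exact: cvg_cst].
  by rewrite subr_eq0 eq_sym.
have neard : \forall t \near z, edge_det e z != 0 ->
  Num.sg (edge_det e t) = Num.sg (edge_det e z).
  have [->|dz] := eqVneq (edge_det e z) 0; first exact: filterE.
  by apply: filterS (near_sgr (@continuous_edge_det e z) dz).
apply: filterS3 (nearx e.1.1) (nearx e.2.1) neard => t.
have L0 := edge_sqr_gt0 ne.
rewrite /inside /edge_wind /vertex_jump /side /step.
(* The cases, in this order: the edge is on the vertical line of [z]; its first
   end point alone is; its second end point alone is; neither is. *)
have [xu|xu] := eqVneq e.1.1 z.1; have [xv|xv] := eqVneq e.2.1 z.1 => nu nv nd.
- rewrite xu xv !subrr sgr0 !mul0r !add0r -mulrBr.
  have y1 : z.2 != e.1.2 by apply: contraNneq z1 => zy;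
    rewrite [z]surjective_pairing [e.1]surjective_pairing xu zy.
  have y2 : z.2 != e.2.2 by apply: contraNneq z2 => zy;
    rewrite [z]surjective_pairing [e.2]surjective_pairing xv zy.
  have dz : edge_det e z = 0 by rewrite /edge_det xu xv !subrr mul0r mulr0 subrr.
  have dt : edge_det e t = - ((e.2.2 - e.1.2) * (t.1 - z.1)).
    by rewrite /edge_det xu xv subrr mul0r sub0r.
  have dot : edge_dot e z = (z.2 - e.1.2) * (e.2.2 - z.2).
    by rewrite /edge_dot xu xv subrr mul0r add0r.
  rewrite dz eqxx /= dot dt sgrN sgrM.
  case: (ltrgtP z.2 e.1.2) y1 => // y1 _; case: (ltrgtP z.2 e.2.2) y2 => // y2 _.
  + have -> : (0 < (z.2 - e.1.2) * (e.2.2 - z.2)) = false by apply/negbTE; rewrite -leNgt; nra.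
    rewrite (ltr0_sg (_ : z.2 - e.1.2 < 0)) ?subr_lt0 //
      (ltr0_sg (_ : z.2 - e.2.2 < 0)) ?subr_lt0 //=.
    by ring.
  + have -> : (0 < (z.2 - e.1.2) * (e.2.2 - z.2)) by nra.
    rewrite (ltr0_sg (_ : z.2 - e.1.2 < 0)) ?subr_lt0 //
      (gtr0_sg (_ : 0 < z.2 - e.2.2)) ?subr_gt0 //.
    by rewrite (ltr0_sg (_ : e.2.2 - e.1.2 < 0)) ?subr_lt0 ?(lt_trans y2) //=; field.
  + have -> : (0 < (z.2 - e.1.2) * (e.2.2 - z.2)) by nra.
    rewrite (gtr0_sg (_ : 0 < z.2 - e.1.2)) ?subr_gt0 //
      (ltr0_sg (_ : z.2 - e.2.2 < 0)) ?subr_lt0 //.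
    by rewrite (gtr0_sg (_ : 0 < e.2.2 - e.1.2)) ?subr_gt0 ?(lt_trans y1) //=; field.
  + have -> : (0 < (z.2 - e.1.2) * (e.2.2 - z.2)) = false by apply/negbTE; rewrite -leNgt; nra.
    rewrite (gtr0_sg (_ : 0 < z.2 - e.1.2)) ?subr_gt0 //
      (gtr0_sg (_ : 0 < z.2 - e.2.2)) ?subr_gt0 //=.
    by ring.
- have y1 : z.2 - e.1.2 != 0.
    rewrite subr_eq0; apply: contraNneq z1 => zy.
    by rewrite [z]surjective_pairing [e.1]surjective_pairing xu zy.
  have q0 : e.2.1 - e.1.1 != 0 by rewrite subr_eq0 xu.
  have dz : edge_det e z = (e.2.1 - e.1.1) * (z.2 - e.1.2).
    by rewrite /edge_det xu subrr mulr0 subr0.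
  have dz0 : edge_det e z != 0 by rewrite dz mulf_neq0.
  rewrite (negbTE dz0) /= nd // nv // dz sgrM xu.
  have s2 : Num.sg (e.2.1 - z.1) * Num.sg (e.2.1 - z.1) = 1.
    by rewrite -expr2 sqr_sg -xu q0.
  rewrite subrr sgr0.
  transitivity ((Num.sg (t.1 - z.1) - Num.sg (z.1 - e.2.1)) / 2 *
    ((Num.sg (e.2.1 - z.1) * Num.sg (e.2.1 - z.1)) * Num.sg (z.2 - e.1.2))); first by ring.
  rewrite s2.
  transitivity ((0 - Num.sg (z.1 - e.2.1)) / 2 *
    ((Num.sg (e.2.1 - z.1) * Num.sg (e.2.1 - z.1)) * Num.sg (z.2 - e.1.2)) +
    (Num.sg (t.1 - z.1) * Num.sg (z.2 - e.1.2) - 0) / 2 + 0 * Num.sg (edge_det e z));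
      last by ring.
  by rewrite s2; ring.
- have y2 : z.2 - e.2.2 != 0.
    rewrite subr_eq0; apply: contraNneq z2 => zy.
    by rewrite [z]surjective_pairing [e.2]surjective_pairing xv zy.
  have q0 : e.2.1 - e.1.1 != 0 by rewrite subr_eq0 xv eq_sym.
  have dz : edge_det e z = (e.2.1 - e.1.1) * (z.2 - e.2.2).
    by rewrite /edge_det xv; ring.
  have dz0 : edge_det e z != 0 by rewrite dz mulf_neq0.
  rewrite (negbTE dz0) /= nd // nu // dz sgrM xv.
  have s2 : Num.sg (z.1 - e.1.1) * Num.sg (z.1 - e.1.1) = 1.
    by rewrite -expr2 sqr_sg -xv q0.
  rewrite subrr sgr0.
  transitivity ((Num.sg (z.1 - e.1.1) - Num.sg (t.1 - z.1)) / 2 *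
    ((Num.sg (z.1 - e.1.1) * Num.sg (z.1 - e.1.1)) * Num.sg (z.2 - e.2.2))); first by ring.
  rewrite s2.
  transitivity ((Num.sg (z.1 - e.1.1) - 0) / 2 *
    ((Num.sg (z.1 - e.1.1) * Num.sg (z.1 - e.1.1)) * Num.sg (z.2 - e.2.2)) +
    (0 - Num.sg (t.1 - z.1) * Num.sg (z.2 - e.2.2)) / 2 + 0 * Num.sg (edge_det e z));
      last by ring.
  by rewrite s2; ring.
- rewrite nu // nv // subrr mul0r addr0.
  have [dz|dz] := eqVneq (edge_det e z) 0; last by rewrite nd // mul0r addr0.
  rewrite dz sgr0 !mulr0 add0r /= mulrA; congr (_ * _).
  have q0 : e.2.1 - e.1.1 != 0.
    apply/eqP => q0; move: dz; rewrite /edge_det q0 mul0r sub0r => /eqP.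
    rewrite oppr_eq0 mulf_eq0 [z.1 - _ == _]subr_eq0 [z.1 == _]eq_sym (negbTE xu) orbF =>
      /eqP p0.
    by move: L0; rewrite q0 p0 !expr0n /= addr0 ltxx.
  have dotE : (e.2.1 - e.1.1) ^+ 2 * edge_dot e z =
      (z.1 - e.1.1) * (e.2.1 - z.1) * ((e.2.1 - e.1.1) ^+ 2 + (e.2.2 - e.1.2) ^+ 2).
    transitivity ((e.2.1 - e.1.1) ^+ 2 * edge_dot e z - edge_det e z *
       ((e.2.1 - e.1.1) * (e.2.2 - z.2) - (e.2.2 - e.1.2) * (z.1 - e.1.1)));
         first by rewrite dz mul0r subr0.
    by rewrite /edge_dot /edge_det; ring.
  have -> : (0 < edge_dot e z) = (0 < (z.1 - e.1.1) * (e.2.1 - z.1)).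
    have q2 : 0 < (e.2.1 - e.1.1) ^+ 2 by rewrite exprn_even_gt0.
    by rewrite -(pmulr_rgt0 _ q2) dotE pmulr_lgt0.
  case: (ltrgtP e.1.1 z.1) xu => // xu _; case: (ltrgtP e.2.1 z.1) xv => // xv _.
  + have -> : (0 < (z.1 - e.1.1) * (e.2.1 - z.1)) = false by apply/negbTE; rewrite -leNgt; nra.
    by rewrite (gtr0_sg (_ : 0 < z.1 - e.1.1)) ?subr_gt0 //
      (gtr0_sg (_ : 0 < z.1 - e.2.1)) ?subr_gt0 // subrr !mul0r.
  + have -> : (0 < (z.1 - e.1.1) * (e.2.1 - z.1)) by nra.
    rewrite (gtr0_sg (_ : 0 < z.1 - e.1.1)) ?subr_gt0 //
      (ltr0_sg (_ : z.1 - e.2.1 < 0)) ?subr_lt0 //.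
    by rewrite (gtr0_sg (_ : 0 < e.2.1 - e.1.1)) ?subr_gt0 ?(lt_trans xu) //=; field.
  + have -> : (0 < (z.1 - e.1.1) * (e.2.1 - z.1)) by nra.
    rewrite (ltr0_sg (_ : z.1 - e.1.1 < 0)) ?subr_lt0 //
      (gtr0_sg (_ : 0 < z.1 - e.2.1)) ?subr_gt0 //.
    by rewrite (ltr0_sg (_ : e.2.1 - e.1.1 < 0)) ?subr_lt0 ?(lt_trans xv) //=; field.
  + have -> : (0 < (z.1 - e.1.1) * (e.2.1 - z.1)) = false by apply/negbTE; rewrite -leNgt; nra.
    by rewrite (ltr0_sg (_ : z.1 - e.1.1 < 0)) ?subr_lt0 //
      (ltr0_sg (_ : z.1 - e.2.1 < 0)) ?subr_lt0 // subrr !mul0r.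
Qed.

End Edges.

(** * The region as a combination of its edges *)

Section Polygon.
Variable R : realType.
Implicit Types (e f : (R * R) * (R * R)) (z t u v : R * R).

Lemma sum_chain_edges (h : R * R -> R) (c : seq (R * R)) :
  \sum_(e <- chain_edges c) (h e.1 - h e.2) = 0.
Proof.
have zipE (s r : seq (R * R)) : size s = size r ->
    \sum_(e <- zip s r) (h e.1 - h e.2) = \sum_(x <- s) h x - \sum_(y <- r) h y.
  elim: s r => [|x s IHs] [|y r] //=; first by rewrite !big_nil subrr.
  by move=> [/IHs sr]; rewrite !big_cons sr /=; ring.
rewrite /chain_edges zipE ?size_rot //.
rewrite [X in _ - X](perm_big c) ?subrr //.
by rewrite perm_rot.
Qed.

Lemma sum_edges (h : R * R -> R) (cs : seq (seq (R * R))) :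
  \sum_(e <- edges cs) (h e.1 - h e.2) = 0.
Proof.
rewrite /edges big_flatten big_map big1_seq // => c _; exact: sum_chain_edges.
Qed.

Definition vertices (es : seq ((R * R) * (R * R))) : seq (R * R) :=
  flatten [seq [:: e.1; e.2] | e <- es].

Lemma mem_vertices es e : e \in es -> e.1 \in vertices es /\ e.2 \in vertices es.
Proof.
by move=> ees; split; apply/flattenP; exists [:: e.1; e.2];
  rewrite ?inE ?eqxx ?orbT //; apply/mapP; exists e.
Qed.

Lemma notin_vertices es z e : z \notin vertices es -> e \in es -> z != e.1 /\ z != e.2.
Proof.
move=> zv /mem_vertices[e1 e2]; split; first by apply: contraNneq zv => ->.
by apply: contraNneq zv => ->.
Qed.

(** The weight that the lattice rule gives to a point. *)
Definition half_weight (P : set (R * R)) z : R := \1_P z + \1_(frontier P) z / 2.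

Lemma continuous_segment z t :
  continuous (fun s : R => (line_path z.1 t.1 s, line_path z.2 t.2 s)).
Proof.
have cl (a b : R) : continuous (line_path a b).
  move=> s; apply: cvgD; apply: cvgM; try exact: cvg_cst; last exact: cvg_id.
  by apply: cvgB; [exact: cvg_cst|exact: cvg_id].
move=> s; exact: (cvg_pair (cl _ _ s) (cl _ _ s)).
Qed.

Section Region.
Variable P : set (R * R).
Hypothesis oP : open P.

Lemma open_not_frontier z : P z -> ~ frontier P z.
Proof. by move=> Pz [_]; apply; move: oP; rewrite openE; apply. Qed.

Lemma half_weight_in z : P z -> half_weight P z = 1.
Proof.
move=> Pz; rewrite /half_weight !indicE mem_set // memNset ?mul0r ?addr0 //.
exact: open_not_frontier.
Qed.

Lemma half_weight_frontier z : frontier P z -> half_weight P z = 1 / 2.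
Proof.
move=> Fz; rewrite /half_weight !indicE memNset ?mem_set ?add0r //.
by move=> /open_not_frontier.
Qed.

Lemma half_weight_out z : ~ P z -> ~ frontier P z -> half_weight P z = 0.
Proof. by move=> Pz Fz; rewrite /half_weight !indicE !memNset // mul0r addr0. Qed.

Lemma near_off_frontier z : ~ frontier P z ->
  \forall t \near z, (P t <-> P z) /\ ~ frontier P t.
Proof.
have [Pz _|nPz nFz] := pselect (P z).
  have zP : \forall t \near z, P t by move: oP; rewrite openE; apply.
  by apply: filterS zP => t Pt; split; [split|exact: open_not_frontier].
have zP : \forall t \near z, ~ closure P t.
  have oC : open (~` closure P) by apply: closed_openC; exact: closed_closure.
  move: oC; rewrite openE; apply => cz; apply: nFz; split => //.
  by move=> /interior_subset.
apply: filterS zP => t Ct; split; last by case.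
by split => // Pt; exfalso; apply: Ct; exact: subset_closure.
Qed.

(** To leave the region one has to cross its frontier. *)
Lemma segment_in_region (z t : R * R) : P z ->
  (forall s : R, s \in `[0, 1] -> ~ frontier P (line_path z.1 t.1 s, line_path z.2 t.2 s)) ->
  P t.
Proof.
move=> Pz nF; pose g s := (line_path z.1 t.1 s, line_path z.2 t.2 s).
have cg : continuous g := @continuous_segment z t.
have := @locally_constant_connected R _ (`[0, 1]%classic : set R) (fun s => `[< P (g s) >])
  (@segment_connected R 0 1) _ 0 1.
have -> : g 0 = z by rewrite /g /line_path subr0 !mul1r !mul0r !addr0 -surjective_pairing.
have -> : g 1 = t by rewrite /g /line_path subrr !mul1r !mul0r !add0r -surjective_pairing.
move=> H; apply/asboolP; rewrite -H.
- exact/asboolP.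
- move=> s s01; have := near_off_frontier (nF s s01).
  move=> /(cg s) H0.
  have {}H0 : \forall r \near s, (P (g r) <-> P (g s)) /\ ~ frontier P (g r) := H0.
  apply: filterS H0 => r [Pr _] _.
  by apply/asbool_equiv_eq.
- by rewrite /= in_itv /= lexx ler01.
- by rewrite /= in_itv /= lexx ler01.
Qed.

End Region.

Section OpenPolygon.
Variables (P : set (R * R)) (cs : seq (seq (R * R))).
Hypothesis polyP : open_polygon cs P.
Let es := edges cs.

Let uniq_es : uniq es. Proof. by case: polyP => -[]. Qed.
Let edge_neq e : e \in es -> e.1 != e.2. Proof. by case: polyP => -[_ h _] _; exact: h. Qed.
Let oP : open P. Proof. by case: polyP => _ []. Qed.
Let frontierE : frontier P = \bigcup_(e in [set` es]) plane_segment e.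
Proof. by case: polyP => _ []. Qed.

Lemma inside_frontier e z : e \in es -> inside e z -> frontier P z.
Proof.
move=> ees /(insideP _ (edge_neq ees))[sz _ _].
by rewrite frontierE; exists e.
Qed.

Lemma frontier_inside z : z \notin vertices es -> frontier P z ->
  exists2 e, e \in es & inside e z.
Proof.
rewrite frontierE => zv [e ees sz]; exists e => //.
by apply/(insideP _ (edge_neq ees)); have [] := notin_vertices zv ees.
Qed.

(** Two edges meet in end points only. *)
Lemma inside_uniq e f z : e \in es -> f \in es -> inside e z ->
  plane_segment f z -> f = e.
Proof.
move=> ees fes /(insideP _ (edge_neq ees))[sz z1 z2] sfz.
apply/eqP; rewrite eq_sym; apply/negP => /negP ef.
case: polyP => -[_ _ /(_ e f ees fes ef z (conj sz sfz))] + _.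
by case=> /= /eqP; apply/negP.
Qed.

Lemma sum_inside e z (F : (R * R) * (R * R) -> R) : e \in es -> inside e z ->
  \sum_(f <- es) (inside f z)%:R * F f = F e.
Proof.
move=> ees ez; rewrite (bigD1_seq e) //= ez mul1r big1_seq ?addr0 // => f /andP[fe fes].
have [fz|] := boolP (inside f z); last by rewrite mul0r.
move/(insideP _ (edge_neq fes)) : (fz) => [sz _ _].
by rewrite (inside_uniq ees fes ez sz) eqxx in fe.
Qed.

Definition winding z : R := \sum_(e <- es) edge_wind e z.

Lemma edge_winds_near z : z \notin vertices es ->
  \forall t \near z, forall e, e \in es -> edge_wind e t = edge_wind e z +
    (vertex_jump z t e.1 - vertex_jump z t e.2) / 2 +
    (inside e z)%:R * Num.sg (edge_det e t).
Proof.
move=> zv; apply: near_all => e ees; have [z1 z2] := notin_vertices zv ees.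
by apply: edge_wind_near => //; exact: edge_neq.
Qed.

(** The vertex terms cancel, so the winding number changes only across edges. *)
Lemma winding_near z : z \notin vertices es ->
  \forall t \near z, winding t = winding z +
    \sum_(e <- es) (inside e z)%:R * Num.sg (edge_det e t).
Proof.
move=> /edge_winds_near H; apply: filterS H => t H.
rewrite /winding (eq_big_seq _ H) !big_split /=; congr (_ + _).
by rewrite -mulr_suml sum_edges mul0r addr0.
Qed.

Lemma region_not_vertex z : P z -> z \notin vertices es.
Proof.
move=> /(open_not_frontier oP) nF; apply/negP => /flattenP[_ /mapP[e ees ->] ze].
apply: nF; rewrite frontierE; exists e => //.
have e12 := edge_neq ees; apply/plane_segmentP => //.
move: ze; rewrite !inE => /orP[/eqP|/eqP] ->; rewrite /edge_det /edge_dot.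
  by rewrite !subrr !mulr0 !mul0r subrr addr0.
by rewrite !subrr !mulr0 addr0 mulrC subrr.
Qed.

Lemma winding_region : exists w, forall z, P z -> winding z = w.
Proof.
have [z0 Pz0] : P !=set0 by case: polyP => _ [].
exists (winding z0) => z Pz.
have cP : connected P by case: polyP => _ [].
apply: (locally_constant_connected cP) => // {z Pz} z Pz.
apply: filterS (winding_near (region_not_vertex Pz)) => t -> _.
rewrite big1_seq ?addr0 // => e /andP[_ ees].
have [/(inside_frontier ees)|] := boolP (inside e z); last by rewrite mul0r.
by move=> /(@open_not_frontier _ oP).
Qed.

(** Near an interior point of an edge the frontier is the line of the edge,
    which cuts a small box into two halves.  Each half is in P or disjoint from P,
    by convexity, and at least one is in P because the edge is in the closure.  Both
    cannot be in P: the winding number takes a single value on P but differs on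
    the two sides.  Its value on P thus tells which side is in P. *)
Lemma edge_sign_near w e z : (forall t, P t -> winding t = w) ->
  e \in es -> z \notin vertices es -> inside e z ->
  \forall t \near z, half_weight P t =
     1 / 2 * (1 + (w - winding z) * Num.sg (edge_det e t)).
Proof.
move=> Pw ees zv ez.
have n1 := winding_near zv.
(* The other edges are closed and avoid [z], so they avoid a neighbourhood. *)
have n2 : \forall t \near z, forall f, f \in es -> plane_segment f t -> f = e.
  apply: near_all => f fes.
  have [->|fe] := eqVneq f e; first exact: filterE.
  have f12 := edge_neq fes.
  have nfz : ~ plane_segment f z by move=> /(inside_uniq ees fes ez) /eqP; apply/negP.
  have [dz|dz] := eqVneq (edge_det f z) 0; last first.
    apply: filterS (near_sgr (@continuous_edge_det _ f z) dz) => t dt.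
    move=> /(plane_segmentP _ f12)[d0 _]; move: dt; rewrite d0 sgr0 => /esym/eqP.
    by rewrite sgr_eq0 (negbTE dz).
  have dot : edge_dot f z < 0.
    by rewrite ltNge; apply/negP => dot; apply: nfz; apply/plane_segmentP.
  apply: filterS (cvgr_lt _ (@continuous_edge_dot _ f z) _ dot) => t dt.
  by move=> /(plane_segmentP _ f12)[_]; rewrite leNgt dt.
have n3 : \forall t \near z, 0 < edge_dot e t.
  by apply: cvgr_gt (@continuous_edge_dot _ e z) _ _; case/andP: ez.
have [r r0 rP] := nbhs_plane_box (filterI n1 (filterI n2 n3)).
have Ft t : `|t.1 - z.1| < r -> `|t.2 - z.2| < r -> frontier P t <-> edge_det e t = 0.
  move=> t1 t2; have [_ [seg dot]] := rP t t1 t2; split.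
    rewrite frontierE => -[f /= fes ft]; move: (ft); rewrite (seg f fes ft).
    by move=> /(plane_segmentP _ (edge_neq ees))[].
  move=> dt; apply: (inside_frontier ees); rewrite /inside dt eqxx /=.
  exact: dot.
have Wt t : `|t.1 - z.1| < r -> `|t.2 - z.2| < r ->
  winding t = winding z + Num.sg (edge_det e t).
  by move=> t1 t2; have [-> _] := rP t t1 t2;
    rewrite (sum_inside (fun f => Num.sg (edge_det f t)) ees ez).
have zB : \forall t \near z, `|t.1 - z.1| < r /\ `|t.2 - z.2| < r.
  apply/nbhs_ballP; exists r => //= t [b1 b2].
  by move: b1 b2; rewrite /ball /= (distrC z.1) (distrC z.2).
have [z' [Pz' [z1 z2]]] : exists z', P z' /\ (`|z'.1 - z.1| < r /\ `|z'.2 - z.2| < r).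
  have [cz _] := inside_frontier ees ez.
  by have [z' [? ?]] := cz _ zB; exists z'.
have d0 : edge_det e z' != 0.
  by apply/eqP => /(Ft _ z1 z2); apply: open_not_frontier oP _ Pz'.
have ww : w - winding z = Num.sg (edge_det e z').
  by rewrite -(Pw _ Pz') Wt // addrAC subrr add0r.
apply: filterS zB => t [t1 t2].
have [dt|dt] := eqVneq (edge_det e t) 0.
  by rewrite (half_weight_frontier oP) ?dt ?sgr0 ?mulr0 ?addr0 ?mulr1 //; apply/(Ft _ t1 t2).
have nFt : ~ frontier P t by move=> /(Ft _ t1 t2)/eqP; apply/negP.
have sd2 : Num.sg (edge_det e t) * Num.sg (edge_det e t) = 1 by rewrite -expr2 sqr_sg dt.
have [Pt|nPt] := pselect (P t).
  rewrite (half_weight_in oP Pt) -(Pw _ Pt) Wt // addrAC subrr add0r sd2.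
  by field.
rewrite half_weight_out // ww.
have [same|] := eqVneq (Num.sg (edge_det e z')) (Num.sg (edge_det e t)).
  exfalso; apply: nPt; apply: (segment_in_region oP Pz') => s.
  rewrite in_itv /= => /andP[s0 s1].
  have conv (a b c : R) : `|a - c| < r -> `|b - c| < r -> `|line_path a b s - c| < r.
    rewrite !ltr_norml /line_path => /andP[a1 a2] /andP[b1 b2].
    have [->|sN0] := eqVneq s 0; first by apply/andP; split; lra.
    have s0' : 0 < s by rewrite lt_neqAle eq_sym sN0.
    by apply/andP; split; nra.
  move=> /(Ft (_, _) (conv _ _ _ z1 t1) (conv _ _ _ z2 t2)).
  have -> : edge_det e (line_path z'.1 t.1 s, line_path z'.2 t.2 s) =
     line_path (edge_det e z') (edge_det e t) s by rewrite /edge_det /line_path /=; ring.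
  rewrite /line_path; move: same.
  case: (ltrgtP (edge_det e z') 0) d0 => // dz' _;
    case: (ltrgtP (edge_det e t) 0) dt => // dt _.
  - by move=> _ ?; nra.
  - by rewrite (ltr0_sg dz') (gtr0_sg dt) => ?; lra.
  - by rewrite (gtr0_sg dz') (ltr0_sg dt) => ?; lra.
  - by move=> _ ?; nra.
case: (ltrgtP (edge_det e z') 0) d0 => // dz' _; case: (ltrgtP (edge_det e t) 0) dt => // dt _.
- by rewrite (ltr0_sg dz') (ltr0_sg dt) eqxx.
- by rewrite (ltr0_sg dz') (gtr0_sg dt) => _; ring.
- by rewrite (gtr0_sg dz') (ltr0_sg dt) => _; ring.
- by rewrite (gtr0_sg dz') (gtr0_sg dt) eqxx.
Qed.

Lemma inside_not_vertex e z : e \in es -> inside e z -> z \notin vertices es.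
Proof.
move=> ees ez; apply/negP => /flattenP[_ /mapP[f fes ->] zf].
have f12 := edge_neq fes.
have sf : plane_segment f z.
  apply/plane_segmentP => //.
  move: zf; rewrite !inE => /orP[/eqP|/eqP] ->; rewrite /edge_det /edge_dot.
    by rewrite !subrr !mulr0 !mul0r subrr addr0.
  by rewrite !subrr !mulr0 addr0 mulrC subrr.
have fe := inside_uniq ees fes ez sf; move: zf; rewrite fe !inE.
by move/(insideP _ (edge_neq ees)): ez => [_ /negbTE -> /negbTE ->].
Qed.

Lemma winding_edge e z z' : e \in es -> inside e z -> inside e z' ->
  winding z = winding z'.
Proof.
move=> ees; have e12 := edge_neq ees.
pose g (s : R) := (line_path e.1.1 e.2.1 s, line_path e.1.2 e.2.2 s).
have ing s : s \in `]0, 1[ -> inside e (g s).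
  rewrite in_itv /= => /andP[s0 s1]; have [d0 dot] := edge_param s e12.
  by rewrite /inside d0 eqxx /= dot !mulr_gt0 ?subr_gt0 ?edge_sqr_gt0.
have gE t : inside e t -> exists2 s, s \in `]0, 1[ & g s = t.
  move=> /(insideP _ e12)[[s + <-]] t1 t2; rewrite /= in_itv /= => /andP[s0 s1].
  exists s => //; rewrite in_itv /= !lt_neqAle s0 s1 !andbT; apply/andP; split.
    apply: contraNneq t1 => <-.
    by rewrite /line_path subr0 !mul1r !mul0r !addr0 -surjective_pairing.
  apply: contraNneq t2 => ->.
  by rewrite /line_path subrr !mul1r !mul0r !add0r -surjective_pairing.
move=> /gE[s s01 <-] /gE[s' s01' <-].
have c01 : connected (`]0, 1[%classic : set R).
  by apply/connected_intervalP; exact: interval_is_interval.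
apply: (@locally_constant_connected R _ _ (winding \o g) c01) => // {s s01 s' s01'} s s01.
have H0 := winding_near (inside_not_vertex ees (ing s s01)).
have {}H0 := @continuous_segment e.1 e.2 s _ H0.
have {}H0 : \forall r \near s, winding (g r) = winding (g s) +
    \sum_(e0 <- es) (inside e0 (g s))%:R * Num.sg (edge_det e0 (g r)) := H0.
apply: filterS H0 => r Hr _; rewrite /= Hr.
rewrite (sum_inside (fun e0 => Num.sg (edge_det e0 (g r))) ees (ing _ s01)).
by have [-> _] := edge_param r e12; rewrite sgr0 addr0.
Qed.

(** The side of an edge on which P lies is determined by the winding number at
    the points of the edge, which is constant along the edge. *)
Lemma edge_sign : exists tau : (R * R) * (R * R) -> R,
  forall e z, e \in es -> inside e z ->
  \forall t \near z, half_weight P t = 1 / 2 * (1 + tau e * Num.sg (edge_det e t)).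
Proof.
have [w Pw] := winding_region.
(* Any interior point of the edge would do. *)
pose mid e := (line_path e.1.1 e.2.1 2^-1, line_path e.1.2 e.2.2 2^-1) : R * R.
exists (fun e => w - winding (mid e)) => e z ees ez.
have e12 := edge_neq ees.
have em : inside e (mid e).
  have [d0 dot] := edge_param 2^-1 e12.
  rewrite /inside d0 eqxx /= dot pmulr_lgt0 ?edge_sqr_gt0 // mulr_gt0 ?invr_gt0 //.
  by rewrite subr_gt0 invf_lt1 // ltr1n.
rewrite (winding_edge ees em ez).
exact: (edge_sign_near Pw ees (inside_not_vertex ees ez) ez).
Qed.

Section Decomposition.
Variable tau : (R * R) * (R * R) -> R.
Hypothesis tauP : forall e z, e \in es -> inside e z ->
  \forall t \near z, half_weight P t = 1 / 2 * (1 + tau e * Num.sg (edge_det e t)).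

Let rest z := half_weight P z - 1 / 2 * \sum_(e <- es) tau e * edge_wind e z.

Lemma half_weight_near z : z \notin vertices es ->
  \forall t \near z, half_weight P t = half_weight P z +
    1 / 2 * \sum_(e <- es) (inside e z)%:R * (tau e * Num.sg (edge_det e t)).
Proof.
move=> zv; have [Fz|nFz] := pselect (frontier P z).
  have [e ees ez] := frontier_inside zv Fz.
  apply: filterS (tauP ees ez) => t ->.
  rewrite (sum_inside (fun e => tau e * Num.sg (edge_det e t)) ees ez).
  by rewrite (half_weight_frontier oP) //; ring.
apply: filterS (near_off_frontier oP nFz) => t [Pt nFt].
rewrite big1_seq ?mulr0 ?addr0; last first.
  move=> e /andP[_ ees]; have [/(inside_frontier ees)//|] := boolP (inside e z).
  by rewrite mul0r.
have [Pz|nPz] := pselect (P z); first by rewrite !half_weight_in //; apply/Pt.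
by rewrite !half_weight_out // => /Pt.
Qed.

(** The jumps of [half_weight] and of the sum of the edges cancel across an
    edge.  What remains is odd in the horizontal displacement: it vanishes on
    vertical lines and cancels on averaging over the left and the right. *)
Lemma rest_near z : z \notin vertices es ->
  exists K, \forall t \near z, rest t = rest z + Num.sg (t.1 - z.1) * K.
Proof.
move=> zv; pose j v : R := if v.1 == z.1 then Num.sg (z.2 - v.2) else 0.
exists (- (1 / 2) * \sum_(e <- es) tau e * ((j e.1 - j e.2) / 2)).
have jE t v : vertex_jump z t v = Num.sg (t.1 - z.1) * j v.
  by rewrite /vertex_jump /j; case: ifP => // _; rewrite mulr0.
apply: filterS2 (half_weight_near zv) (edge_winds_near zv) => t Ht We.
rewrite /rest Ht.
have -> : \sum_(e <- es) tau e * edge_wind e t =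
   \sum_(e <- es) tau e * edge_wind e z +
   Num.sg (t.1 - z.1) * (\sum_(e <- es) tau e * ((j e.1 - j e.2) / 2)) +
   \sum_(e <- es) (inside e z)%:R * (tau e * Num.sg (edge_det e t)).
  rewrite mulr_sumr -!big_split; apply: eq_big_seq => e ees.
  by rewrite (We e ees) !jE /=; ring.
by ring.
Qed.

Lemma rest_vertical x y y' :
  (forall v, v \in vertices es -> v.1 != x) -> rest (x, y) = rest (x, y').
Proof.
move=> xv.
have cT : connected [set: R] by apply/connected_intervalP.
apply: (@locally_constant_connected R _ _ (fun y => rest (x, y)) cT) => // {y y'} y _.
have zv : (x, y) \notin vertices es.
  by apply/negP => /xv /=; rewrite eqxx.
have [K H0] := rest_near zv.
have cy : continuous (fun s : R => (x, s)).
  by move=> s; apply: (cvg_pair (cvg_cst x) cvg_id).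
have {}H0 := cy y _ H0.
have {}H0 : \forall s \near y, rest (x, s) = rest (x, y) + Num.sg (x - x) * K := H0.
by apply: filterS H0 => s -> _; rewrite subrr sgr0 mul0r addr0.
Qed.

(** Far above all edges and far below them, the contributions are opposite; this
    makes the integration constant of [rest] vanish. *)
Lemma edge_wind_above e z : e.1.2 < z.2 -> e.2.2 < z.2 ->
  edge_wind e z = step e.1.1 e.2.1 z.1.
Proof.
move=> z1 z2; rewrite /edge_wind /side.
have dE : edge_det e z = (e.2.1 - z.1) * (z.2 - e.1.2) + (z.1 - e.1.1) * (z.2 - e.2.2).
  by rewrite /edge_det; ring.
have [->|step0] := eqVneq (step e.1.1 e.2.1 z.1) 0; first by rewrite mul0r.
rewrite -[RHS]mulr1; congr (_ * _).
have stepl : z.1 < e.1.1 -> z.1 < e.2.1 -> step e.1.1 e.2.1 z.1 = 0.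
  rewrite -subr_lt0 -[_ < e.2.1]subr_lt0 /step => h1 h2.
  by rewrite (ltr0_sg h1) (ltr0_sg h2) subrr mul0r.
have stepr : e.1.1 < z.1 -> e.2.1 < z.1 -> step e.1.1 e.2.1 z.1 = 0.
  rewrite -subr_gt0 -[e.2.1 < _]subr_gt0 /step => h1 h2.
  by rewrite (gtr0_sg h1) (gtr0_sg h2) subrr mul0r.
case: (ltrgtP e.1.1 e.2.1) => h.
- have [x1|x1] := ltP z.1 e.1.1; first by move: step0; rewrite stepl ?eqxx // (lt_trans x1).
  have [x2|x2] := ltP e.2.1 z.1; first by move: step0; rewrite stepr ?eqxx // (lt_trans _ x2).
  have d0 : 0 < edge_det e z.
    have [x3|x3] := ltP z.1 e.2.1; rewrite dE.
      by apply: ltr_pwDl; [apply: mulr_gt0|apply: mulr_ge0]; lra.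
    by apply: ltr_wpDl; [apply: mulr_ge0|apply: mulr_gt0]; lra.
  by rewrite (gtr0_sg d0) gtr0_sg ?subr_gt0 // mulr1.
- have [x1|x1] := ltP z.1 e.2.1; first by move: step0; rewrite stepl ?eqxx // (lt_trans x1).
  have [x2|x2] := ltP e.1.1 z.1; first by move: step0; rewrite stepr ?eqxx // (lt_trans _ x2).
  have d0 : edge_det e z < 0.
    rewrite -oppr_gt0; have [x3|x3] := ltP e.2.1 z.1; rewrite dE opprD -!mulNr.
      by apply: ltr_pwDl; [apply: mulr_gt0|apply: mulr_ge0]; lra.
    by apply: ltr_wpDl; [apply: mulr_ge0|apply: mulr_gt0]; lra.
  by rewrite (ltr0_sg d0) ltr0_sg ?subr_lt0 // mulrNN mulr1.
- by move: step0; rewrite /step h subrr mul0r eqxx.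
Qed.

Lemma edge_wind_below e z : z.2 < e.1.2 -> z.2 < e.2.2 ->
  edge_wind e z = - step e.1.1 e.2.1 z.1.
Proof.
move=> z1 z2; pose f := ((e.1.1, - e.1.2), (e.2.1, - e.2.2)).
have := @edge_wind_above f (z.1, - z.2); rewrite /= !ltrN2 => /(_ z1 z2) <-.
rewrite /edge_wind /= -mulrN; congr (_ * _); rewrite /side /= -mulrN -sgrN.
by congr (_ * Num.sg _); rewrite /edge_det /=; ring.
Qed.

Lemma region_bounded : exists A, forall z, P z \/ frontier P z \/ z \in vertices es ->
  `|z.1| < A /\ `|z.2| < A.
Proof.
have [B [_ /(_ (B + 1) (ltr_pwDr ltr01 (lexx B))) PB]] : bounded_set P by case: polyP => _ [].
pose C := \sum_(v <- vertices es) (`|v.1| + `|v.2|).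
have vC v : v \in vertices es -> `|v.1| <= C /\ `|v.2| <= C.
  move=> vv; have vC : `|v.1| + `|v.2| <= C.
    rewrite /C; elim: (vertices es) vv => //= u s IHs;
      rewrite inE big_cons => /predU1P[<-|/IHs h].
      by rewrite lerDl sumr_ge0 // => i _; rewrite addr_ge0.
    by rewrite (le_trans h) // lerDr addr_ge0.
  by have := normr_ge0 v.1; have := normr_ge0 v.2; split; lra.
have C0 : 0 <= C by rewrite sumr_ge0 // => i _; rewrite addr_ge0.
exists (`|B + 1| + C + 1) => z.
have B0 := ler_norm (B + 1).
have BN0 := normr_ge0 (B + 1).
case=> [/PB /= zB|[Fz|/vC[v1 v2]]].
- have z1 : `|z.1| <= `|z| by rewrite prod_normE le_max lexx.
  have z2 : `|z.2| <= `|z| by rewrite prod_normE le_max lexx orbT.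
  by split; lra.
- move: Fz; rewrite frontierE => -[e /= ees [s + <-]].
  rewrite /= in_itv /= => /andP[s0 s1].
  have [e1 e2] := mem_vertices ees.
  have [a1 a2] := vC _ e1; have [b1 b2] := vC _ e2.
  have conv (a b : R) : `|a| <= C -> `|b| <= C -> `|line_path a b s| <= C.
    rewrite !ler_norml /line_path => /andP[? ?] /andP[? ?].
    by apply/andP; split; nra.
  by split; [have := conv _ _ a1 b1|have := conv _ _ a2 b2]; lra.
- by split; lra.
Qed.

Lemma rest_far : exists2 M, 0 < M & forall x,
  [/\ rest (x, M) = - (1 / 2) * \sum_(e <- es) tau e * step e.1.1 e.2.1 x,
      rest (x, - M) = 1 / 2 * \sum_(e <- es) tau e * step e.1.1 e.2.1 x &
      (x, M) \notin vertices es].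
Proof.
have [A AP] := region_bounded.
have [z0 Pz0] : P !=set0 by case: polyP => _ [].
have A0 : 0 < A by have [h _] := AP z0 (or_introl Pz0); exact: le_lt_trans (normr_ge0 _) h.
exists A => // x.
have far y : `|y| = A -> half_weight P (x, y) = 0.
  move=> yA; apply: half_weight_out => h.
    by have [_] := AP _ (or_introl h); rewrite /= yA ltxx.
  by have [_] := AP _ (or_intror (or_introl h)); rewrite /= yA ltxx.
have vA e : e \in es -> (`|e.1.2| < A) /\ (`|e.2.2| < A).
  move=> ees; have [e1 e2] := mem_vertices ees.
  by have [_ ?] := AP _ (or_intror (or_intror e1));
    have [_ ?] := AP _ (or_intror (or_intror e2)).
split; rewrite /rest.
- rewrite far ?gtr0_norm // sub0r -mulNr; congr (_ * _); apply: eq_big_seq => e /vA[+ +].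
  rewrite !ltr_norml => /andP[a1 a2] /andP[b1 b2].
  by rewrite edge_wind_above.
- rewrite far ?normrN ?gtr0_norm // sub0r -mulrN; congr (_ * _).
  rewrite -sumrN; apply: eq_big_seq => e /vA[+ +].
  rewrite !ltr_norml => /andP[a1 a2] /andP[b1 b2].
  by rewrite edge_wind_below // mulrN opprK.
- apply/negP => h; have [_] := AP _ (or_intror (or_intror h)).
  by rewrite /= gtr0_norm // ltxx.
Qed.

(** On a vertical line without vertices [rest] is constant, with opposite values
    far up and far down.  On the other lines it is the average of its values on
    both sides. *)
Lemma rest0 z : z \notin vertices es -> rest z = 0.
Proof.
move=> zv; have [M M0 MP] := rest_far.
have line x y : (forall v, v \in vertices es -> v.1 != x) -> rest (x, y) = 0.
  move=> xv; have [h1 h2 _] := MP x.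
  have r1 := rest_vertical y M xv; have r2 := rest_vertical y (- M) xv.
  by move: r1 r2; rewrite h1 h2; lra.
have [K n1] := rest_near zv.
have n2 : \forall t \near z, forall v, v \in vertices es -> v.1 != z.1 -> t.1 - v.1 != 0.
  apply: near_all => v vv; have [->|vz] := eqVneq v.1 z.1; first exact: filterE.
  have vz' : z.1 - v.1 != 0 by rewrite subr_eq0 eq_sym.
  apply: filterS (@near_sgr _ (fun t => t.1 - v.1) z _ vz') => [t st _|].
    by rewrite -sgr_eq0 st sgr_eq0.
  by apply: cvgB; [exact: continuous_fst|exact: cvg_cst].
have [r r0 rP] := nbhs_plane_box (filterI n1 n2).
have off (s : R) : s != 0 -> `|s| < r -> rest z + Num.sg s * K = 0.
  have zs : z.1 + s - z.1 = s by rewrite addrAC subrr add0r.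
  move=> s0 sr; have [] := rP (z.1 + s, z.2); rewrite /= ?zs ?subrr ?normr0 //.
  move=> <- nv; apply: line => v vv; have [->|/(nv v vv)] := eqVneq v.1 z.1.
    by rewrite -subr_eq0 opprD addrA subrr add0r oppr_eq0.
  by rewrite subr_eq0 eq_sym.
have r2 : 0 < r / 2 by rewrite divr_gt0.
have := off (r / 2); have := off (- (r / 2)).
rewrite oppr_eq0 gt_eqF // normrN gtr0_norm // sgrN gtr0_sg //.
have -> : r / 2 < r by lra.
move=> /(_ isT isT) h1 /(_ isT isT) h2.
lra.
Qed.

(** On each vertical line as many edges have P above them as below, if the end
    points count half.  So any function of [z.2] can be subtracted from all the
    [side e], which makes the supports bounded. *)
Lemma sum_step0 x : \sum_(e <- es) tau e * step e.1.1 e.2.1 x = 0.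
Proof.
have [M M0 /(_ x)[h _ /rest0]] := rest_far.
by rewrite h => /eqP; rewrite mulf_eq0 oppr_eq0 div1r invr_eq0 pnatr_eq0 /= => /eqP.
Qed.

End Decomposition.

Lemma half_weight_decomposition : exists c : (R * R) * (R * R) -> R,
  forall M z, z \notin vertices es ->
  half_weight P z = \sum_(e <- es) c e * (step e.1.1 e.2.1 z.1 *
     (side e z - (Num.sg (z.2 - M) + Num.sg (z.2 + M)) / 2)).
Proof.
have [tau tauP] := edge_sign; exists (fun e => 1 / 2 * tau e) => M z zv.
have /eqP := rest0 tauP zv; rewrite subr_eq0 => /eqP ->.
rewrite mulr_sumr.
transitivity (\sum_(e <- es) 1 / 2 * (tau e * edge_wind e z) -
  1 / 2 * (Num.sg (z.2 - M) + Num.sg (z.2 + M)) / 2 * \sum_(e <- es) tau e * step e.1.1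
    e.2.1 z.1).
  by rewrite (sum_step0 tauP) mulr0 subr0.
rewrite mulr_sumr -sumrB; apply: eq_bigr => e _.
by rewrite /edge_wind; ring.
Qed.

End OpenPolygon.
End Polygon.

(** * The defect of the lattice rule *)

Section LatticeDefect.
Variable R : realType.
Implicit Types (u v : R * R -> R) (N : nat).

Local Notation PT := (measurableTypeR R * measurableTypeR R)%type.
Local Notation plane := ((@lebesgue_measure R) \x (@lebesgue_measure R))%E.

(** Boundedness and bounded support make both terms of the defect finite. *)
Definition admissible u :=
  measurable_fun [set: PT] u /\
  exists A, forall z, u z != 0 -> [/\ `|z.1| <= A, `|z.2| <= A & `|u z| <= A].

Definition lattice_sum N u : R := \sum_(n \in [set: int * int]) u (scaled_point N n).

Definition defect N u : R := \int[plane]_z u z - N%:R ^- 2 * lattice_sum N u.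

Lemma lattice_sum_box N u (s t : int) (m n : nat) :
  (forall k : int * int, u (scaled_point N k) != 0 ->
     s <= k.1 <= s + m%:Z /\ t <= k.2 <= t + n%:Z) ->
  lattice_sum N u =
  \sum_(i < m.+1) \sum_(j < n.+1) u (scaled_point N (s + i%:Z, t + j%:Z)).
Proof.
move=> ubox.
pose r := [seq (s + i%:Z, t + j%:Z) | i <- iota 0 m.+1, j <- iota 0 n.+1].
have rP (k : int * int) : s <= k.1 <= s + m%:Z -> t <= k.2 <= t + n%:Z -> k \in r.
  case: k => k l /= /andP[sk km] /andP[tl ln]; apply/allpairsP.
  exists (`|k - s|%N, `|l - t|%N); rewrite !mem_iota !add0n /=.
  rewrite !ltnS -!lez_nat !gez0_abs ?subr_ge0 //; split => //; last first.
    by congr (_, _); lia.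
  - lia.
  - lia.
rewrite /lattice_sum (fsbigE r) //.
- rewrite (eq_bigl xpredT) => [|i]; last by rewrite in_setT.
  rewrite big_allpairs_dep /= /index_iota.
  rewrite -(big_mkord xpredT (fun i => \sum_(j < n.+1) u (scaled_point N (s + i%:Z, t +
    j%:Z)))).
  rewrite /index_iota subn0; apply: eq_bigr => i _.
  by rewrite -(big_mkord xpredT (fun j => u (scaled_point N (s + i%:Z, t + j%:Z))))
    /index_iota subn0.
- apply: allpairs_uniq; rewrite ?iota_uniq //.
  by move=> [i j] [i' j'] _ _ /= [] /addrI [->] /addrI [->].
- move=> k _ kr; apply/eqP; apply: contraNT kr => /ubox[].
  exact: rP.
Qed.

Lemma admissible_lattice N u v : (0 < N)%N -> admissible u -> admissible v ->
  exists K : nat, forall w, (forall z, w z != 0 -> u z != 0 \/ v z != 0) ->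
  lattice_sum N w =
  \sum_(i < K.*2.+1) \sum_(j < K.*2.+1) w (scaled_point N (i%:Z - K%:Z, j%:Z - K%:Z)).
Proof.
move=> N0 [_ [A uA]] [_ [B vB]].
pose K := `|Num.ceil (N%:R * (`|A| + `|B|))|%N.
have NR : 0 < N%:R :> R by rewrite ltr0n.
have KP (k : int) : N%:R^-1 * `|k%:~R| <= `|A| + `|B| -> - K%:Z <= k <= K%:Z.
  rewrite ler_pdivrMl // -ler_norml => h.
  have K0 : 0 <= Num.ceil (N%:R * (`|A| + `|B|)).
    rewrite -(ler_int R); apply: le_trans (ceil_ge _).
    by rewrite mulr_ge0 // ?addr_ge0 // ltW.
  rewrite /K gez0_abs // -(ler_int R) intr_norm.
  by apply: le_trans h (ceil_ge _).
exists K => w wuv.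
rewrite (@lattice_sum_box _ _ (- K%:Z) (- K%:Z) K.*2 K.*2).
  by apply: eq_bigr => i _; apply: eq_bigr => j _; rewrite ![- K%:Z + _]addrC.
have eK : - K%:Z + (K.*2)%:Z = K%:Z by rewrite -addnn PoszD; lia.
rewrite eK => k /wuv kuv.
suff [h1 h2] : `|(scaled_point N k).1 : R| <= `|A| + `|B| /\ `|(scaled_point N k).2 : R| <=
  `|A| + `|B|.
  by split; apply: KP; [move: h1|move: h2]; rewrite /= normrM gtr0_norm ?invr_gt0.
case: kuv => [/uA|/vB] [h1 h2 _]; split.
- by rewrite (le_trans h1) // (le_trans (ler_norm _)) // lerDl.
- by rewrite (le_trans h2) // (le_trans (ler_norm _)) // lerDl.
- by rewrite (le_trans h1) // (le_trans (ler_norm _)) // lerDr.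
- by rewrite (le_trans h2) // (le_trans (ler_norm _)) // lerDr.
Qed.

Lemma lattice_sumD N u v : (0 < N)%N -> admissible u -> admissible v ->
  lattice_sum N (u \+ v) = lattice_sum N u + lattice_sum N v.
Proof.
move=> N0 au av; have [K KP] := admissible_lattice N0 au av.
rewrite !KP; [|by move=> z; right|by move=> z; left|].
  by rewrite -big_split; apply: eq_bigr => i _; rewrite -big_split.
by move=> z /=; have [->|] := eqVneq (u z) 0; [rewrite add0r; right | left].
Qed.

Lemma measurable_box (a b c d : R) :
  measurable (`[a, b]%classic `*` `[c, d]%classic : set PT).
Proof. by apply: measurableX; apply: measurable_itv. Qed.

Lemma plane_box (a b c d : R) : a <= b -> c <= d ->
  plane (`[a, b]%classic `*` `[c, d]%classic) = ((b - a) * (d - c))%:E.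
Proof.
move=> ab cd; rewrite product_measure1E //; try exact: measurable_itv.
rewrite /= !lebesgue_measure_itv /= !lte_fin.
have -> : (if a < b then (b%:E - a%:E)%E else 0%E) = (b - a)%:E.
  by case: ltgtP ab => // -> _; rewrite subrr.
have -> : (if c < d then (d%:E - c%:E)%E else 0%E) = (d - c)%:E.
  by case: ltgtP cd => // -> _; rewrite subrr.
by rewrite -EFinM.
Qed.

Lemma integrable_box u B a b c d : measurable_fun [set: PT] u ->
  (forall z, u z != 0 -> z.1 \in `[a, b] /\ z.2 \in `[c, d]) ->
  (forall z, `|u z| <= B) -> a <= b -> c <= d ->
  plane.-integrable setT (EFin \o u) /\
  `|\int[plane]_z u z| <= B * ((b - a) * (d - c)).
Proof.
move=> mu ubox uB ab cd.
pose Q : set PT := `[a, b]%classic `*` `[c, d]%classic.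
have mQ : measurable Q by exact: measurable_box.
have uQ : u = (u \_ Q).
  apply/funext => z; rewrite patchE; case: ifPn => //.
  by apply: contraNeq => /ubox [? ?]; rewrite inE.
have finQ : (plane Q < +oo)%E by rewrite /Q plane_box // ltry.
have iQ : plane.-integrable Q (EFin \o u).
  apply: (@measurable_bounded_integrable _ _ _ plane) => //.
  - exact: measurable_funTS.
  - exists B; split; first exact: num_real.
    by move=> y By z _; apply: le_trans (uB z) (ltW By).
split.
  have -> : EFin \o u = ((EFin \o u) \_ Q).
    by rewrite restrict_EFin; congr (_ \o _).
  exact: (iffLR (integrable_mkcond _ mQ)).
rewrite uQ -Rintegral_mkcond.
apply: (le_trans (le_normr_Rintegral _ iQ)) => //.
apply: (@le_trans _ _ (\int[plane]_(z in Q) (cst B z))).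
  apply: le_Rintegral => //.
  - by have := integrable_norm iQ.
  - apply: (@measurable_bounded_integrable _ _ _ plane) => //.
    exists B; split; first exact: num_real.
    move=> y By z _; rewrite /= ger0_norm; first exact: ltW.
    exact: le_trans (uB z).
rewrite Rintegral_cst //.
have -> : fine (plane Q) = (b - a) * (d - c) by rewrite /Q plane_box.
by [].
Qed.

Lemma admissible_integrable u : admissible u -> plane.-integrable setT (EFin \o u).
Proof.
move=> [mu [A uA]].
have uA' z : u z != 0 -> [/\ `|z.1| <= `|A|, `|z.2| <= `|A| & `|u z| <= `|A|].
  by move=> /uA[? ? ?]; split; apply: le_trans (ler_norm A).
apply: (proj1 (@integrable_box u `|A| (- `|A|) `|A| (- `|A|) `|A| mu _ _ _ _)) => //.
- by move=> z /uA'[]; rewrite !in_itv /= -!ler_norml.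
- by move=> z; have [->|/uA'[]//] := eqVneq (u z) 0; rewrite normr0.
- by rewrite -subr_ge0 opprK addr_ge0.
- by rewrite -subr_ge0 opprK addr_ge0.
Qed.

Lemma admissible_measurable u : admissible u -> measurable_fun [set: PT] u.
Proof. by case. Qed.

Lemma admissibleD u v : admissible u -> admissible v -> admissible (u \+ v).
Proof.
move=> [mu [A uA]] [mv [B vB]]; split; first exact: measurable_funD.
exists (`|A| + `|B|) => z /= uvz.
have uA' : `|u z| <= `|A|.
  by have [->|/uA[_ _ h]] := eqVneq (u z) 0; rewrite ?normr0 // (le_trans h) // ler_norm.
have vB' : `|v z| <= `|B|.
  by have [->|/vB[_ _ h]] := eqVneq (v z) 0; rewrite ?normr0 // (le_trans h) // ler_norm.
have uv' : `|u z + v z| <= `|A| + `|B|.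
  by apply: le_trans (ler_normD _ _) _; apply: lerD.
have [u0|/uA[h1 h2 _]] := eqVneq (u z) 0.
  have : v z != 0 by move: uvz; rewrite u0 add0r.
  move=> /vB[h1 h2 _]; split => //.
  - by rewrite (le_trans h1) // (le_trans (ler_norm _)) // lerDr.
  - by rewrite (le_trans h2) // (le_trans (ler_norm _)) // lerDr.
split => //.
- by rewrite (le_trans h1) // (le_trans (ler_norm _)) // lerDl.
- by rewrite (le_trans h2) // (le_trans (ler_norm _)) // lerDl.
Qed.

Lemma admissibleZ (c : R) u : admissible u -> admissible (fun z => c * u z).
Proof.
move=> [mu [A uA]]; split; first exact: measurable_funM.
exists (`|A| + `|c| * `|A|) => z /= cu.
have /uA[h1 h2 h3] : u z != 0 by apply: contraNneq cu => ->; rewrite mulr0.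
have cA : 0 <= `|c| * `|A| by apply: mulr_ge0.
split.
- by rewrite (le_trans h1) // (le_trans (ler_norm _)) // lerDl.
- by rewrite (le_trans h2) // (le_trans (ler_norm _)) // lerDl.
- rewrite normrM (@le_trans _ _ (`|c| * `|A|)) ?lerDr //.
  by apply: ler_wpM2l => //; apply: le_trans h3 (ler_norm _).
Qed.

Lemma admissible0 : admissible (fun=> 0).
Proof. by split; [exact: measurable_cst | exists 0 => z; rewrite eqxx]. Qed.

Lemma admissible_sum (I : Type) (r : seq I) (F : I -> R * R -> R) :
  (forall i, admissible (F i)) -> admissible (fun z => \sum_(i <- r) F i z).
Proof.
move=> aF; elim: r => [|i r IHr].
  under eq_fun do rewrite big_nil; exact: admissible0.
under eq_fun do rewrite big_cons.
exact: (admissibleD (aF i) IHr).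
Qed.

Lemma defectD N u v : (0 < N)%N -> admissible u -> admissible v ->
  defect N (u \+ v) = defect N u + defect N v.
Proof.
move=> N0 au av; rewrite /defect lattice_sumD //.
rewrite RintegralD //; [by ring|exact: admissible_integrable..].
Qed.

Lemma defectZ N c u : admissible u ->
  defect N (fun z => c * u z) = c * defect N u.
Proof.
move=> au; rewrite /defect RintegralZl //; last exact: admissible_integrable.
by rewrite /lattice_sum -mulr_fsumr mulrBr mulrCA.
Qed.

Lemma defect0 N : defect N (fun=> 0) = 0.
Proof.
rewrite -[RHS](mul0r (defect N (fun=> 0))) -(defectZ N 0 admissible0).
by congr defect; apply/funext => z; rewrite mul0r.
Qed.

Lemma defect_sum N (I : Type) (r : seq I) (F : I -> R * R -> R) : (0 < N)%N ->
  (forall i, admissible (F i)) ->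
  defect N (fun z => \sum_(i <- r) F i z) = \sum_(i <- r) defect N (F i).
Proof.
move=> N0 aF; elim: r => [|i r IHr].
  by under eq_fun do rewrite big_nil; rewrite big_nil defect0.
under eq_fun do rewrite big_cons.
rewrite big_cons -IHr -defectD //; exact: admissible_sum.
Qed.

Definition reflection (c : R * R) (z : PT) : PT := (c.1 - z.1, c.2 - z.2).

Lemma measurable_reflection c : measurable_fun [set: PT] (reflection c).
Proof.
by apply: measurable_fun_pair; apply: measurable_funB.
Qed.

(** By uniqueness of product measures it is enough to reflect intervals. *)
Lemma plane_reflection (c : R * R) (A : set PT) : measurable A ->
  pushforward plane (reflection c) A = plane A.
Proof.
have mr (a : R) : measurable_fun setT (fun x : measurableTypeR R => (a - x :
  measurableTypeR R)).
  by apply: measurable_funB.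
have line a (B : set (measurableTypeR R)) : measurable B ->
    lebesgue_measure ((fun x : R => a - x) @^-1` B) = lebesgue_measure B.
  move=> mB.
  rewrite -[LHS]/(pushforward lebesgue_measure (fun x : measurableTypeR R => (a - x :
    measurableTypeR R)) B).
  apply/esym/lebesgue_measure_unique => //= _ [[x y]] _ <-.
  rewrite /pushforward.
  have -> : (fun x => a - x) @^-1` `]x, y]%classic = `[a - y, a - x[%classic.
    by apply/seteqP; split=> t /=; rewrite !in_itv /= => /andP[h1 h2]; apply/andP; split; lra.
  rewrite !lebesgue_measure_itv /= !lte_fin ltrD2l ltrN2.
  by case: ifP => // _; rewrite -!EFinB; congr EFin; ring.
have mphi := measurable_reflection c.
move=> mA; apply/esym.
apply: (@product_measure_unique _ _ _ _ _ (@lebesgue_measure R) (@lebesgue_measure R)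
  (pushforward plane (reflection c))) => // B C mB mC.
rewrite -[LHS]/(plane (((fun x : R => c.1 - x) @^-1` B) `*` ((fun x : R => c.2 - x) @^-1` C))).
rewrite product_measure1E.
- by congr (_ * _)%E; exact: line.
- by rewrite -[X in measurable X]setTI; apply: mr.
- by rewrite -[X in measurable X]setTI; apply: mr.
Qed.

Lemma Rintegral_reflection (c : R * R) u : admissible u ->
  \int[plane]_z u (reflection c z) = \int[plane]_z u z.
Proof.
move=> au; have iu := admissible_integrable au.
have mc := measurable_reflection c.
have iu' : plane.-integrable (reflection c @^-1` setT) ((EFin \o u) \o reflection c).
  have aur : admissible (u \o reflection c).
    split; first by apply: measurableT_comp => //; case: au.
    case: au => _ [A uA]; exists (`|A| + `|c.1| + `|c.2|) => z /uA[h1 h2 h3].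
    move: h1 h2; rewrite /= (distrC c.1) (distrC c.2) => h1 h2.
    have A0 := ler_norm A; have := normr_ge0 c.1; have := normr_ge0 c.2 => c2 c1.
    have t1 : `|z.1| <= `|z.1 - c.1| + `|c.1| by rewrite -[in X in X <= _](subrK c.1 z.1)
      ler_normD.
    have t2 : `|z.2| <= `|z.2 - c.2| + `|c.2| by rewrite -[in X in X <= _](subrK c.2 z.2)
      ler_normD.
    by split; lra.
  exact: (admissible_integrable aur).
rewrite /Rintegral; congr fine.
have := @integral_pushforward _ _ _ _ R (reflection c) mc plane setT (EFin \o u) _ iu'
  measurableT.
rewrite preimage_setT => <-; last exact: measurable_int iu.
by apply: eq_measure_integral => A mA _; exact: plane_reflection.
Qed.

(** The centre is half of the lattice point [c], so the reflection preserves the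
    lattice as well as the measure. *)
Lemma defect_odd N u (c : int * int) : (0 < N)%N -> admissible u ->
  (forall z, u (reflection (scaled_point N c) z) = - u z) -> defect N u = 0.
Proof.
move=> N0 au odd.
have i0 : \int[plane]_z u z = 0.
  have := Rintegral_reflection (scaled_point N c) au.
  under eq_Rintegral do rewrite odd -mulN1r.
  rewrite RintegralZl //; last exact: admissible_integrable.
  by lra.
have s0 : lattice_sum N u = 0.
  pose f (n : int * int) : int * int := (c.1 - n.1, c.2 - n.2).
  have bf : bijective f.
    by exists f; move=> [n m]; rewrite /f /= !subKr.
  have : lattice_sum N u = - lattice_sum N u.
    rewrite {1}/lattice_sum (@reindex_fsbigT _ _ _ _ _ f _ bf) /lattice_sum -mulN1r mulr_fsumr.
    apply: eq_fsbigr => n _; rewrite mulN1r -odd; congr u.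
    by rewrite /scaled_point /reflection /f /= !intrB !mulrBr.
  by lra.
by rewrite /defect i0 s0 mulr0 subr0.
Qed.

(** The integral is bounded through the area of the box, the sum through its
    number of lattice points. *)
Lemma defect_box N u B (s t : int) (m n : nat) : (0 < N)%N ->
  measurable_fun [set: PT] u ->
  (forall z, `|u z| <= B) ->
  (forall z, u z != 0 -> s%:~R <= N%:R * z.1 <= (s + m%:Z)%:~R /\
                         t%:~R <= N%:R * z.2 <= (t + n%:Z)%:~R) ->
  `|defect N u| <= B * (m * n + m.+1 * n.+1)%:R / N%:R ^+ 2.
Proof.
move=> N0 mu uB ubox.
have NR : 0 < N%:R :> R by rewrite ltr0n.
have NR0 : N%:R != 0 :> R by rewrite gt_eqF.
rewrite /defect; apply: le_trans (ler_normB _ _) _.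
rewrite natrD mulrDr mulrDl; apply: lerD.
  have := @integrable_box u B (s%:~R / N%:R) ((s + m%:Z)%:~R / N%:R)
    (t%:~R / N%:R) ((t + n%:Z)%:~R / N%:R) mu.
  case=> //.
  - move=> z /ubox; rewrite !in_itv /= !ler_pdivrMr // !ler_pdivlMr //.
    by rewrite ![_ * N%:R]mulrC.
  - by rewrite ler_pM2r ?invr_gt0 // ler_int lerDl.
  - by rewrite ler_pM2r ?invr_gt0 // ler_int lerDl.
  move=> _ /le_trans; apply.
  rewrite !intrD natrM -!pmulrn.
  by rewrite le_eqVlt; apply/orP; left; apply/eqP; field.
rewrite (@lattice_sum_box N u s t m n) => [|k]; last first.
  move=> /ubox; rewrite /scaled_point /= !mulrA !divff // !mul1r.
  by rewrite !ler_int.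
rewrite normrM ger0_norm ?invr_ge0 ?exprn_ge0 // [X in X <= _]mulrC.
apply: ler_wpM2r; first by rewrite invr_ge0 exprn_ge0 // ltW.
apply: le_trans (ler_norm_sum _ _ _) _.
apply: (@le_trans _ _ (\sum_(i < m.+1) \sum_(j < n.+1) B)).
  apply: ler_sum => i _; apply: le_trans (ler_norm_sum _ _ _) _.
  by apply: ler_sum => j _; apply: uB.
by rewrite !sumr_const !card_ord -mulrnA mulr_natr mulnC.
Qed.

End LatticeDefect.

(** * Measure theory of the plane *)

Section PlaneMeasure.
Variable R : realType.

Local Notation PT := (measurableTypeR R * measurableTypeR R)%type.
Local Notation plane := ((@lebesgue_measure R) \x (@lebesgue_measure R))%E.

(** The rational boxes form a countable basis. *)
Lemma open_plane_measurable (U : set PT) : open (U : set (R * R)) -> measurable U.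
Proof.
move=> oU.
pose box (q : rat * rat * (rat * rat)) : set PT :=
  `]ratr q.1.1, ratr q.1.2[%classic `*` `]ratr q.2.1, ratr q.2.2[%classic.
have -> : U = \bigcup_q (if `[< box q `<=` U >] then box q else set0).
  apply/seteqP; split => [z Uz|z [q _]]; last by case: asboolP => // bU /bU.
  have /nbhs_plane_box[e e0 eU] : nbhs (z : R * R) U by move: oU; rewrite openE; apply.
  have [q1 +] := @rat_in_itvoo R (z.1 - e) z.1 ltac:(lra).
  have [q2 +] := @rat_in_itvoo R z.1 (z.1 + e) ltac:(lra).
  have [q3 +] := @rat_in_itvoo R (z.2 - e) z.2 ltac:(lra).
  have [q4 +] := @rat_in_itvoo R z.2 (z.2 + e) ltac:(lra).
  rewrite !in_itv /= => /andP[a1 a2] /andP[a3 a4] /andP[a5 a6] /andP[a7 a8].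
  exists ((q1, q2), (q3, q4)) => //; rewrite asboolT.
    by split; rewrite /= in_itv /=; apply/andP; split.
  move=> t [] /=; rewrite !in_itv /= => /andP[b1 b2] /andP[b3 b4].
  by apply: eU; rewrite ltr_norml; apply/andP; split; lra.
apply: countable_bigcupT_measurable => [|q]; first exact: countableP.
case: ifP => // _.
by apply: measurableX; exact: measurable_itv.
Qed.

Lemma continuous_plane_measurable (f : R * R -> R) : continuous f ->
  measurable_fun [set: PT] (f : PT -> R).
Proof.
move=> /continuousP cf mD; apply: (measurability _ (RGenOpens.measurableE R)) => //.
move=> _ [_ [a [b ->] <-]]; rewrite setTI.
apply: open_plane_measurable; apply: cf; exact: interval_open.
Qed.

Lemma measurable_sgr d (T : measurableType d) (f : T -> R) :
  measurable_fun setT f -> measurable_fun setT (fun x => Num.sg (f x)).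
Proof.
move=> mf; rewrite (_ : (fun x => _) =
  (fun x => if f x < 0 then -1 else if 0 < f x then 1 else 0)).
  apply: measurable_fun_ifT; [exact: measurable_fun_ltr|exact: measurable_cst|].
  by apply: measurable_fun_ifT; [exact: measurable_fun_ltr|exact: measurable_cst..].
by apply/funext => x; case: ltgtP => h; rewrite ?(gtr0_sg h) ?(ltr0_sg h) ?h ?sgr0.
Qed.

Definition line_set (a b c : R) : set PT := [set z | a * z.1 + b * z.2 = c].

Lemma measurable_line_set a b c : measurable (line_set a b c).
Proof.
have mf : measurable_fun [set: PT] (fun z : PT => a * z.1 + b * z.2 : R).
  by apply: measurable_funD; apply: measurable_funM.
by have := mf measurableT [set c] (measurable_set1 c); rewrite setTI.
Qed.

Lemma plane_line_set a b c : (a != 0) || (b != 0) -> plane (line_set a b c) = 0%E.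
Proof.
have [->|b0 _] := eqVneq b 0; first rewrite /= orbF => a0.
  have -> : line_set a 0 c = [set c / a]%classic `*` setT.
    apply/seteqP; split => z; rewrite /line_set /= mul0r addr0.
      by move=> <-; split => //; rewrite mulrC mulKf.
    by move=> [-> _]; rewrite mulrC divfK.
  by rewrite product_measure1E //= lebesgue_measure_set1 mul0e.
rewrite /product_measure1; apply: integral0_eq => x _ /=.
have -> : xsection (line_set a b c) x = [set (c - a * x) / b]%classic.
  apply/seteqP; split => y; rewrite /xsection /= inE /line_set /=.
    by move=> <-; rewrite addrC addKr mulrC mulKf.
  by move=> ->; field.
exact: lebesgue_measure_set1.
Qed.

(** This disposes of the edges of polygons and the sides of cells. *)
Lemma Rintegral_null (u v : R * R -> R) (s : seq (R * R * R)) :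
  admissible u -> admissible v ->
  (forall l, l \in s -> (l.1.1 != 0) || (l.1.2 != 0)) ->
  (forall z, u z != v z -> exists2 l, l \in s & line_set l.1.1 l.1.2 l.2 z) ->
  \int[plane]_z u z = \int[plane]_z v z.
Proof.
move=> au av s0 us; have nS : plane.-negligible (\big[setU/set0]_(l <- s) line_set l.1.1
  l.1.2 l.2).
  elim: s s0 {us} => [|l s IHs] s0; first by rewrite big_nil; exact: negligible_set0.
  rewrite big_cons; apply: negligibleU; last by apply: IHs => m ms; apply: s0;
    rewrite inE ms orbT.
  exists (line_set l.1.1 l.1.2 l.2); split => //; first exact: measurable_line_set.
  by apply: plane_line_set; apply: s0; rewrite mem_head.
rewrite /Rintegral; congr fine; apply: ae_eq_integral => //.
- exact: measurable_int (admissible_integrable au).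
- exact: measurable_int (admissible_integrable av).
- apply: negligibleS nS => z /= /not_implyP[_ uv].
  have /us[l ls lz] : u z != v z by apply: contra_notN uv => /eqP; rewrite /= => ->.
  by rewrite -bigcup_seq; exists l.
Qed.

End PlaneMeasure.

(** * Taylor estimates on boxes *)

Section Calculus.
Variable R : realType.
Implicit Types (f g : R * R -> R) (z t : R * R).

Lemma continuous_bounded_box f (A : R) : continuous f ->
  exists2 K, 0 <= K & forall z, `|z.1| <= A -> `|z.2| <= A -> `|f z| <= K.
Proof.
move=> cf; pose Q : set (R * R) := `[- A, A]%classic `*` `[- A, A]%classic.
have cQ : compact Q by apply: compact_setX; exact: segment_compact.
have cfQ : compact (f @` Q) by apply: continuous_compact => //; exact: continuous_subspaceT.
have [B [_ /(_ (B + 1) (ltr_pwDr ltr01 (lexx B))) fB]] := @compact_bounded R R^o _ cfQ.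
exists `|B + 1| => // z z1 z2; apply: le_trans (ler_norm _).
apply: fB => /=; exists z => //.
by split; rewrite /= in_itv /= -ler_norml.
Qed.

Lemma is_derive_line1 f (s y : R) : derivable f (s, y) (1, 0) ->
  is_derive s 1 (fun s : R => f (s, y)) ('D_(1, 0) f (s, y)).
Proof.
have E : (fun h : R => h^-1 *: ((f \o shift (s, y)) (h *: (1, 0)) - f (s, y))) =
         (fun h : R => h^-1 *: (((fun s : R => f (s, y)) \o shift s) (h *: (1 : R)) - f (s,
           y))).
  apply/funext => h /=; congr (_ *: (f _ - _)).
  by rewrite [LHS]surjective_pairing /=; congr (_, _); rewrite ?scaler0 ?add0r.
rewrite /derivable E => df; apply: DeriveDef => //.
by rewrite /derive E.
Qed.

Lemma is_derive_line2 f (x s : R) : derivable f (x, s) (0, 1) ->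
  is_derive s 1 (fun s : R => f (x, s)) ('D_(0, 1) f (x, s)).
Proof.
have E : (fun h : R => h^-1 *: ((f \o shift (x, s)) (h *: (0, 1)) - f (x, s))) =
         (fun h : R => h^-1 *: (((fun s : R => f (x, s)) \o shift s) (h *: (1 : R)) - f (x,
           s))).
  apply/funext => h /=; congr (_ *: (f _ - _)).
  by rewrite [LHS]surjective_pairing /=; congr (_, _); rewrite ?scaler0 ?add0r.
rewrite /derivable E => df; apply: DeriveDef => //.
by rewrite /derive E.
Qed.

(** With [c = 0] this bounds increments; with [c] a value of the derivative it
    bounds Taylor remainders. *)
Lemma mean_value_inequality (h dh : R -> R) (a b c K : R) :
  (forall s : R, is_derive s 1 h (dh s)) ->
  (forall s, Num.min a b <= s <= Num.max a b -> `|dh s - c| <= K) ->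
  `|h b - h a - c * (b - a)| <= K * `|b - a|.
Proof.
move=> hd dK.
wlog ab : a b dK / a <= b.
  move=> H; have [ab|/ltW ba] := leP a b; first exact: H.
  have dK' s : Num.min b a <= s <= Num.max b a -> `|dh s - c| <= K.
    by rewrite minC maxC; exact: dK.
  have -> : h b - h a - c * (b - a) = - (h a - h b - c * (a - b)) by ring.
  by rewrite normrN (distrC b a); exact: H.
have ch : {within `[a, b], continuous h}.
  apply: continuous_subspaceT => s; apply: differentiable_continuous.
  by apply/derivable1_diffP; have [] := hd s.
have [s sab ->] := MVT_segment ab (fun s _ => hd s) ch.
rewrite -mulrBl normrM ler_wpM2r //; apply: dK.
by rewrite min_l // max_r //; move: sab; rewrite in_itv.
Qed.

Lemma between_box (a b s A : R) : `|a| <= A -> `|b| <= A ->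
  Num.min a b <= s <= Num.max a b -> `|s| <= A /\ `|s - a| <= `|b - a|.
Proof.
rewrite ler_norml => /andP[a1 a2]; rewrite ler_norml => /andP[b1 b2].
case: (leP a b) => ab /andP[s1 s2].
  split; first by rewrite ler_norml; apply/andP; split; lra.
  by rewrite !ger0_norm ?subr_ge0 //; lra.
split; first by rewrite ler_norml; apply/andP; split; lra.
by rewrite !ler0_norm ?subr_le0 //; lra.
Qed.

Lemma lipschitz_box f (A : R) : continuously_differentiable 1 f ->
  exists2 K, 0 <= K & forall z t, `|z.1| <= A -> `|z.2| <= A -> `|t.1| <= A -> `|t.2| <= A ->
    `|f t - f z| <= K * (`|t.1 - z.1| + `|t.2 - z.2|).
Proof.
case=> cf df cf1 cf2.
have [K1 K10 fK1] := continuous_bounded_box A cf1.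
have [K2 K20 fK2] := continuous_bounded_box A cf2.
exists (K1 + K2) => [|[z1 z2] [t1 t2] /= hz1 hz2 ht1 ht2]; first exact: addr_ge0.
have h1 : `|f (t1, t2) - f (z1, t2) - 0 * (t1 - z1)| <= K1 * `|t1 - z1|.
  apply: (@mean_value_inequality (fun s => f (s, t2)) (fun s => 'D_(1, 0) f (s, t2))).
    by move=> s; apply: is_derive_line1; case: (df (s, t2)).
  by move=> s /(between_box hz1 ht1)[sA _]; rewrite subr0; exact: fK1.
have h2 : `|f (z1, t2) - f (z1, z2) - 0 * (t2 - z2)| <= K2 * `|t2 - z2|.
  apply: (@mean_value_inequality (fun s => f (z1, s)) (fun s => 'D_(0, 1) f (z1, s))).
    by move=> s; apply: is_derive_line2; case: (df (z1, s)).
  by move=> s /(between_box hz2 ht2)[sA _]; rewrite subr0; exact: fK2.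
move: h1 h2; rewrite !mul0r !subr0 => h1 h2.
have -> : f (t1, t2) - f (z1, z2) = (f (t1, t2) - f (z1, t2)) + (f (z1, t2) - f (z1, z2))
  by ring.
apply: le_trans (ler_normD _ _) _; apply: le_trans (lerD h1 h2) _.
by have := normr_ge0 (t1 - z1); have := normr_ge0 (t2 - z2); nra.
Qed.

(** The path goes first in the second coordinate and then in the first; the
    partial derivatives vary along it by a multiple of its length. *)
Lemma taylor_box f (A : R) : continuously_differentiable 2 f ->
  exists2 K, 0 <= K & forall z t, `|z.1| <= A -> `|z.2| <= A -> `|t.1| <= A -> `|t.2| <= A ->
    `|f t - f z - 'D_(1, 0) f z * (t.1 - z.1) - 'D_(0, 1) f z * (t.2 - z.2)| <=
    K * (`|t.1 - z.1| + `|t.2 - z.2|) ^+ 2.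
Proof.
case=> cf df cf1 cf2.
have [K1 K10 fK1] := lipschitz_box A cf1.
have [K2 K20 fK2] := lipschitz_box A cf2.
exists (K1 + K2) => [|[z1 z2] [t1 t2] /= hz1 hz2 ht1 ht2]; first exact: addr_ge0.
set d1 := 'D_(1, 0) f (z1, z2); set d2 := 'D_(0, 1) f (z1, z2).
pose r := `|t1 - z1| + `|t2 - z2|.
have r1 : `|t1 - z1| <= r by rewrite lerDl.
have r2 : `|t2 - z2| <= r by rewrite lerDr.
have h1 : `|f (t1, t2) - f (z1, t2) - d1 * (t1 - z1)| <= K1 * r * `|t1 - z1|.
  apply: (@mean_value_inequality (fun s => f (s, t2)) (fun s => 'D_(1, 0) f (s, t2))).
    by move=> s; apply: is_derive_line1; case: (df (s, t2)).
  move=> s /(between_box hz1 ht1)[sA sz].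
  apply: (le_trans (fK1 (z1, z2) (s, t2) hz1 hz2 sA ht2)) => /=.
  by apply: ler_wpM2l => //; apply: lerD.
have h2 : `|f (z1, t2) - f (z1, z2) - d2 * (t2 - z2)| <= K2 * r * `|t2 - z2|.
  apply: (@mean_value_inequality (fun s => f (z1, s)) (fun s => 'D_(0, 1) f (z1, s))).
    by move=> s; apply: is_derive_line2; case: (df (z1, s)).
  move=> s /(between_box hz2 ht2)[sA sz].
  apply: (le_trans (fK2 (z1, z2) (z1, s) hz1 hz2 hz1 sA)) => /=.
  by apply: ler_wpM2l => //; rewrite subrr normr0 add0r; apply: le_trans sz _.
have -> : f (t1, t2) - f (z1, z2) - d1 * (t1 - z1) - d2 * (t2 - z2) =
  (f (t1, t2) - f (z1, t2) - d1 * (t1 - z1)) + (f (z1, t2) - f (z1, z2) - d2 * (t2 - z2))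
    by ring.
apply: le_trans (ler_normD _ _) _; apply: le_trans (lerD h1 h2) _.
have r0 : 0 <= r by apply: addr_ge0.
by rewrite mulrDl expr2 !mulrA; apply: lerD; apply: ler_wpM2l => //; apply: mulr_ge0.
Qed.

End Calculus.

(** * Cells, rectangles and pieces around an edge *)

Section Estimates.
Variable R : realType.
Implicit Types (u g : R * R -> R) (e : (R * R) * (R * R)) (z : R * R) (N : nat).

Local Notation PT := (measurableTypeR R * measurableTypeR R)%type.
Local Notation plane := ((@lebesgue_measure R) \x (@lebesgue_measure R))%E.

Lemma step_sym (a b x : R) : step a b (a + b - x) = step a b x.
Proof.
rewrite /step.
have -> : a + b - x - a = - (x - b) by ring.
have -> : a + b - x - b = - (x - a) by ring.
by rewrite !sgrN; ring.
Qed.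

Lemma stepC (a b x : R) : step b a x = - step a b x.
Proof. by rewrite /step; ring. Qed.

Lemma sum_step (f : nat -> R) (n : nat) (x : R) :
  \sum_(i < n) step (f i) (f i.+1) x = step (f 0) (f n) x.
Proof.
elim: n => [|n IHn]; first by rewrite big_ord0 /step subrr mul0r.
by rewrite big_ord_recr /= IHn /step; ring.
Qed.

Lemma sgr_le1 (x : R) : `|Num.sg x| <= 1.
Proof. by rewrite normr_sg; case: (x != 0). Qed.

Lemma step_le1 (a b x : R) : `|step a b x| <= 1.
Proof.
rewrite /step normrM (ger0_norm (_ : 0 <= 2^-1)) ?invr_ge0 // ler_pdivrMr // mul1r.
by apply: le_trans (ler_normB _ _) _; have := sgr_le1 (x - a); have := sgr_le1 (x - b); lra.
Qed.

Lemma step_neq0 (a b x : R) : step a b x != 0 -> Num.min a b <= x <= Num.max a b.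
Proof.
apply: contraNT; rewrite negb_and -!ltNge lt_min gt_max => /orP[] /andP[h1 h2].
  by rewrite /step !ltr0_sg ?subr_lt0 // subrr mul0r.
by rewrite /step !gtr0_sg ?subr_gt0 // subrr mul0r.
Qed.

Lemma step_neq0_le (a b x : R) : a <= b -> step a b x != 0 -> a <= x <= b.
Proof. by move=> ab /step_neq0; rewrite min_l ?max_r. Qed.

Lemma step_l (a b : R) : a < b -> step a b a = 1 / 2.
Proof. by move=> ab; rewrite /step subrr sgr0 ltr0_sg ?subr_lt0 // sub0r opprK. Qed.

Lemma step_r (a b : R) : a < b -> step a b b = 1 / 2.
Proof. by move=> ab; rewrite /step subrr sgr0 gtr0_sg ?subr_gt0 // subr0. Qed.

Lemma step_in (a b x : R) : a < x -> x < b -> step a b x = 1.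
Proof.
move=> ax xb; rewrite /step gtr0_sg ?subr_gt0 // ltr0_sg ?subr_lt0 // opprK.
by rewrite -[1 + 1]/(2 : R) divff.
Qed.

Lemma measurable_step d (T : measurableType d) (f : T -> R) (a b : R) :
  measurable_fun setT f -> measurable_fun setT (fun x => step a b (f x)).
Proof.
move=> mf; apply: measurable_funM => //.
by apply: measurable_funB; apply: measurable_sgr; exact: measurable_funB.
Qed.

Lemma measurable_fst_plane : measurable_fun [set: PT] (fst : PT -> R).
Proof. exact: measurable_fst. Qed.

Lemma measurable_snd_plane : measurable_fun [set: PT] (snd : PT -> R).
Proof. exact: measurable_snd. Qed.

(** A rectangle with weight 1/2 on its sides and 1/4 at its corners. *)
Definition rect (a b c d : R) z : R := step a b z.1 * step c d z.2.

Lemma measurable_rect a b c d : measurable_fun [set: PT] (rect a b c d).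
Proof.
apply: measurable_funM; apply: measurable_step.
  exact: measurable_fst_plane.
exact: measurable_snd_plane.
Qed.

Lemma rect_le1 a b c d z : `|rect a b c d z| <= 1.
Proof. by rewrite normrM mulr_ile1 ?step_le1. Qed.

Lemma measurable_edge_wind e : measurable_fun [set: PT] (edge_wind e).
Proof.
apply: measurable_funM; first by apply: measurable_step; exact: measurable_fst_plane.
apply: measurable_funM => //; apply: measurable_sgr.
by apply: continuous_plane_measurable; exact: continuous_edge_det.
Qed.

Lemma admissible_bounded u (A B : R) : measurable_fun [set: PT] u ->
  (forall z, `|u z| <= B) -> (forall z, u z != 0 -> `|z.1| <= A /\ `|z.2| <= A) ->
  admissible u.
Proof.
move=> mu uB uA; split => //; exists (`|A| + `|B|) => z /uA[z1 z2].
have := ler_norm A; have := ler_norm B; have := normr_ge0 A; have := normr_ge0 B.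
by have := uB z; split; lra.
Qed.

Lemma admissibleM u g : admissible u -> continuous g -> admissible (fun z => u z * g z).
Proof.
move=> [mu [A uA]] cg; have [K K0 gK] := continuous_bounded_box A cg.
apply: (@admissible_bounded _ A (`|A| * K)).
- by apply: measurable_funM => //; exact: continuous_plane_measurable.
- move=> z; have [->|/uA[z1 z2 uz]] := eqVneq (u z) 0.
    by rewrite mul0r normr0 mulr_ge0.
  by rewrite normrM ler_pM // ?gK // (le_trans uz) // ler_norm.
- by move=> z uz; have /uA[] : u z != 0 by apply: contraNneq uz => ->; rewrite mul0r.
Qed.

Lemma admissible_rect a b c d : admissible (rect a b c d).
Proof.
apply: (@admissible_bounded _ (`|a| + `|b| + `|c| + `|d|) 1).
- exact: measurable_rect.
- exact: rect_le1.
- have bnd (x y t : R) : step x y t != 0 -> `|t| <= `|x| + `|y|.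
    move=> /step_neq0/andP[]; rewrite ge_min le_max => h1 h2.
    have := ler_norm x; have := ler_norm y; have := ler_norm (- x); have := ler_norm (- y).
    rewrite !normrN => ? ? ? ?; have ? := normr_ge0 x; have ? := normr_ge0 y.
    rewrite ler_norml; apply/andP; split.
      by case/orP: h1 => ?; lra.
    by case/orP: h2 => ?; lra.
  move=> z; rewrite mulf_eq0 negb_or => /andP[/bnd h1 /bnd h2].
  have ? := normr_ge0 a; have ? := normr_ge0 b; have ? := normr_ge0 c; have ? := normr_ge0 d.
  by split; lra.
Qed.

Lemma Rintegral_rect (a b c d : R) : a < b -> c < d ->
  \int[plane]_z rect a b c d z = (b - a) * (d - c).
Proof.
move=> ab cd; pose Q : set PT := `[a, b]%classic `*` `[c, d]%classic.
have mQ : measurable Q := measurable_box a b c d.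
rewrite (@Rintegral_null _ _ (\1_Q) [:: (1, 0, a); (1, 0, b); (0, 1, c); (0, 1, d)]).
- rewrite /Rintegral; under eq_integral do rewrite /=.
  by rewrite integral_indic // setIT [X in fine X](_ : _ = ((b - a) * (d - c))%:E) //;
    apply: plane_box; exact: ltW.
- exact: admissible_rect.
- apply: (@admissible_bounded _ (`|a| + `|b| + `|c| + `|d|) 1).
  + exact: measurable_indic.
  + by move=> z; rewrite indicE; case: (_ \in _); rewrite ?normr1 ?normr0.
  + move=> z; rewrite indicE pnatr_eq0 eqb0 negbK inE => -[/=]; rewrite !in_itv /=.
    move=> /andP[? ?] /andP[? ?].
    have := ler_norm b; have := ler_norm d; have := ler_norm (- a); have := ler_norm (- c).
    rewrite !normrN => ? ? ? ?.
    have ? := normr_ge0 a; have ? := normr_ge0 b; have ? := normr_ge0 c; have ? := normr_ge0 d.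
    by split; rewrite ler_norml; apply/andP; split; lra.
- by move=> l; rewrite !inE => /or4P[] /eqP -> /=; rewrite oner_eq0 ?orbT.
- move=> z; apply: contraPP => nl.
  have nl1 (k r : R) (i : R) : (k, r, i) \in [:: (1, 0, a); (1, 0, b); (0, 1, c);
    (0, 1, d)] -> k * z.1 + r * z.2 <> i.
    by move=> lin E; apply: nl; exists (k, r, i).
  have za : z.1 != a by apply/eqP => E; apply: (@nl1 1 0 a);
    rewrite ?inE ?eqxx // mul1r mul0r addr0.
  have zb : z.1 != b by apply/eqP => E; apply: (@nl1 1 0 b);
    rewrite ?inE ?eqxx ?orbT // mul1r mul0r addr0.
  have zc : z.2 != c by apply/eqP => E; apply: (@nl1 0 1 c);
    rewrite ?inE ?eqxx ?orbT // mul1r mul0r add0r.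
  have zd : z.2 != d by apply/eqP => E; apply: (@nl1 0 1 d);
    rewrite ?inE ?eqxx ?orbT // mul1r mul0r add0r.
  apply/negP; rewrite negbK; apply/eqP.
  rewrite indicE /rect; have [zQ|zQ] := boolP (z \in Q).
    move: zQ; rewrite inE => -[/=]; rewrite !in_itv /= !le_eqVlt.
    rewrite ![a == _]eq_sym ![c == _]eq_sym (negbTE za) (negbTE zb) (negbTE zc) (negbTE zd) /=.
    by move=> /andP[? ?] /andP[? ?]; rewrite !step_in ?mulr1.
  apply/eqP; apply: contraNT zQ; rewrite mulf_eq0 negb_or => /andP[].
  move=> /(step_neq0_le (ltW ab)) h1 /(step_neq0_le (ltW cd)) h2.
  by rewrite inE; split; rewrite /= in_itv.
Qed.

Definition node N (k : int) : R := k%:~R / N%:R.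

Lemma node_lt N (s t : int) : (0 < N)%N -> (node N s < node N t) = (s < t).
Proof. by move=> N0; rewrite /node ltr_pM2r ?invr_gt0 ?ltr0n // ltr_int. Qed.

Lemma node_le N (s t : int) : (0 < N)%N -> (node N s <= node N t) = (s <= t).
Proof. by move=> N0; rewrite /node ler_pM2r ?invr_gt0 ?ltr0n // ler_int. Qed.

Lemma nodeD N (s t : int) : node N (s + t) = node N s + node N t.
Proof. by rewrite /node intrD mulrDl. Qed.

Lemma step_node_support N (s : int) (m : nat) (x : R) : (0 < N)%N ->
  step (node N s) (node N (s + m%:Z)) x != 0 -> s%:~R <= N%:R * x <= (s + m%:Z)%:~R.
Proof.
move=> N0 /step_neq0_le; rewrite node_le // lerDl => /(_ isT).
by rewrite /node ler_pdivrMr ?ler_pdivlMr ?ltr0n // mulrC.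
Qed.

(** The four corners of weight 1/4 make up for the area of a cell. *)
Lemma defect_cell N (s t : int) : (0 < N)%N ->
  defect N (rect (node N s) (node N (s + 1)) (node N t) (node N (t + 1))) = 0.
Proof.
move=> N0; have NR : N%:R != 0 :> R by rewrite pnatr_eq0 -lt0n.
have lt1 k : node N k < node N (k + 1) by rewrite node_lt // ltzD1.
rewrite /defect Rintegral_rect //.
rewrite (@lattice_sum_box _ _ _ s t 1 1) => [|k]; last first.
  rewrite mulf_eq0 negb_or => /andP[/(@step_node_support N s 1 _ N0) + /(@step_node_support
    N t 1 _ N0)].
  by rewrite /scaled_point /= !mulrA !divff // !mul1r !ler_int.
have val (k l : int) : scaled_point N (k, l) = (node N k, node N l).
  by rewrite /scaled_point /node /= ![N%:R^-1 * _]mulrC.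
rewrite !big_ord_recl !big_ord0 /= !val /rect /= !addr0 !step_l ?step_r //.
rewrite !nodeD /node; field.
by [].
Qed.

(** The defect kills the constant part of the Taylor expansion about the centre
    by [defect_cell] and the linear part by oddness.  The remainder is O(N^-2)
    on a set of area and mass O(N^-2). *)
Lemma cell_estimate g (A : R) : continuously_differentiable 2 g ->
  exists2 K, 0 <= K & forall N (s t : int), (0 < N)%N ->
    - A <= node N s -> node N (s + 1) <= A -> - A <= node N t -> node N (t + 1) <= A ->
    `|defect N (fun z => rect (node N s) (node N (s + 1)) (node N t) (node N (t + 1)) z * g z)|
      <= K / N%:R ^+ 4.
Proof.
move=> g2; have cg : continuous g by case: g2.
have [K K0 gK] := taylor_box A g2.
exists (K * 5) => [|N s t N0 s1 s2 t1 t2]; first exact: mulr_ge0.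
have NR : 0 < N%:R :> R by rewrite ltr0n.
have lt1 k : node N k < node N (k + 1) by rewrite node_lt // ltzD1.
have d1 k : node N (k + 1) = node N k + N%:R^-1 by rewrite nodeD /node mul1r.
pose c : R * R := (node N s + N%:R^-1 / 2, node N t + N%:R^-1 / 2).
have Ninv : 0 < N%:R^-1 :> R by rewrite invr_gt0.
have c1A : `|c.1| <= A by rewrite ler_norml /=; rewrite d1 in s2; apply/andP; split; lra.
have c2A : `|c.2| <= A by rewrite ler_norml /=; rewrite d1 in t2; apply/andP; split; lra.
set cell := rect _ _ _ _.
have acell : admissible cell by exact: admissible_rect.
pose gx := 'D_(1, 0) g c; pose gy := 'D_(0, 1) g c.
pose lin z := gx * (z.1 - c.1) + gy * (z.2 - c.2).
have clin : continuous lin.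
  move=> z; apply: cvgD; apply: cvgM; try exact: cvg_cst.
    by apply: cvgB; [exact: continuous_fst|exact: cvg_cst].
  by apply: cvgB; [exact: continuous_snd|exact: cvg_cst].
pose rem z := g z - g c - gx * (z.1 - c.1) - gy * (z.2 - c.2).
have crem : continuous rem.
  have -> : rem = fun z => g z - (g c + lin z).
    by apply/funext => z; rewrite /rem /lin; ring.
  by move=> z; apply: cvgB; [exact: cg|apply: cvgD; [exact: cvg_cst|exact: clin]].
have -> : (fun z => cell z * g z) =
    (fun z => g c * cell z) \+ ((fun z => cell z * lin z) \+ (fun z => cell z * rem z)).
  by apply/funext => z /=; rewrite /rem /lin; ring.
have al := admissibleM acell clin; have ar := admissibleM acell crem.
rewrite defectD //; [|exact: admissibleZ|exact: admissibleD].
rewrite defectD // defectZ // defect_cell // mulr0 add0r.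
rewrite (@defect_odd _ N _ (s + s + 1, t + t + 1)) // ?add0r; last first.
  move=> z; rewrite /reflection /scaled_point /=.
  have cE (k : int) : N%:R^-1 * (k + k + 1)%:~R = node N k + node N (k + 1).
    by rewrite d1 /node !intrD; field; rewrite gt_eqF.
  rewrite !cE /cell /rect /= !step_sym -mulrN; congr (_ * _).
  by rewrite /lin /= !d1 /c /=; field; rewrite gt_eqF.
have := @defect_box _ N (fun z => cell z * rem z) (K / N%:R ^+ 2) s t 1 1 N0.
have -> : K / N%:R ^+ 2 * (1 * 1 + 2 * 2)%:R / N%:R ^+ 2 = K * 5 / N%:R ^+ 4.
  by field; rewrite gt_eqF.
apply.
- exact: admissible_measurable.
- move=> z; have [->|cz] := eqVneq (cell z) 0.
    by rewrite mul0r normr0 mulr_ge0 // invr_ge0 exprn_ge0 // ltW.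
  rewrite normrM; apply: (@le_trans _ _ (1 * `|rem z|)).
    by apply: ler_wpM2r => //; exact: rect_le1.
  rewrite mul1r; move: cz; rewrite mulf_eq0 negb_or => /andP[].
  move=> /(step_neq0_le (ltW (lt1 s)))/andP[zs1 zs2] /(step_neq0_le (ltW (lt1 t)))/andP[zt1
    zt2].
  apply: (le_trans (gK c z c1A c2A _ _)).
  + by rewrite ler_norml; apply/andP; split; lra.
  + by rewrite ler_norml; apply/andP; split; lra.
  + apply: ler_wpM2l => //; rewrite -exprVn.
    rewrite lerXn2r ?nnegrE ?addr_ge0 ?(ltW Ninv) //.
    have -> : N%:R^-1 = N%:R^-1 / 2 + N%:R^-1 / 2 :> R by field; rewrite gt_eqF.
    rewrite d1 in zs2 s2; rewrite d1 in zt2 t2.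
    by apply: lerD; rewrite ler_norml /=; apply/andP; split; lra.
- move=> z; rewrite mulf_eq0 negb_or => /andP[+ _].
  rewrite mulf_eq0 negb_or => /andP[/(@step_node_support N s 1 _ N0) + /(@step_node_support
    N t 1 _ N0)].
  by [].
Qed.

(** A rectangle is the sum of its cells, at every point, by [sum_step]. *)
Lemma rect_estimate g (A : R) : continuously_differentiable 2 g ->
  exists2 K, 0 <= K & forall N (s t : int) (m n : nat), (0 < N)%N ->
    - A <= node N s -> node N (s + m%:Z) <= A -> - A <= node N t -> node N (t + n%:Z) <= A ->
    `|defect N (fun z => rect (node N s) (node N (s + m%:Z)) (node N t) (node N (t + n%:Z))
      z * g z)|
      <= (m * n)%:R * (K / N%:R ^+ 4).
Proof.
move=> g2; have cg : continuous g by case: g2.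
have [K K0 cellK] := cell_estimate A g2.
exists K => // N s t m n N0 s1 s2 t1 t2.
pose cell i j z := rect (node N (s + Posz i)) (node N (s + Posz i + 1))
   (node N (t + Posz j)) (node N (t + Posz j + 1)) z * g z.
have acell i j : admissible (cell i j) by apply: admissibleM => //; exact: admissible_rect.
have nodeS (k : int) (i : nat) : node N (k + Posz i + 1) = node N (k + Posz i.+1).
  by rewrite -addrA -PoszD addn1.
have -> : (fun z => rect (node N s) (node N (s + m%:Z)) (node N t) (node N (t + n%:Z)) z *
  g z) =
   (fun z => \sum_(i < m) \sum_(j < n) cell i j z).
  apply/funext => z; rewrite /rect.
  have := sum_step (fun i => node N (s + Posz i)) m z.1; rewrite addr0 => <-.
  have := sum_step (fun i => node N (t + Posz i)) n z.2; rewrite addr0 => <-.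
  rewrite -mulrA mulr_suml; apply: eq_bigr => i _.
  rewrite mulrCA mulr_suml; apply: eq_bigr => j _.
  by rewrite /cell /rect !nodeS; ring.
rewrite (defect_sum _ N0) => [|i]; last exact: admissible_sum.
apply: le_trans (ler_norm_sum _ _ _) _.
rewrite natrM -mulrA -[m in m%:R](card_ord m) mulr_natl -sumr_const.
apply: ler_sum => i _; rewrite (defect_sum _ N0) //.
apply: le_trans (ler_norm_sum _ _ _) _.
rewrite -[n in n%:R](card_ord n) mulr_natl -sumr_const.
apply: ler_sum => j _; apply: cellK => //; rewrite ?nodeS.
- by rewrite (le_trans s1) // node_le // lerDl.
- by rewrite (le_trans _ s2) // node_le // lerD2l lez_nat.
- by rewrite (le_trans t1) // node_le // lerDl.
- by rewrite (le_trans _ t2) // node_le // lerD2l lez_nat.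
Qed.

(** The part of the weight of an edge that is left when the edge is replaced by
    the average of the horizontal lines through its end points.  It lives on the
    rectangle of which the edge is a diagonal. *)
Definition edge_diagonal e z : R :=
  edge_wind e z - step e.1.1 e.2.1 z.1 * ((Num.sg (z.2 - e.1.2) + Num.sg (z.2 - e.2.2)) / 2).

Lemma measurable_edge_diagonal e : measurable_fun [set: PT] (edge_diagonal e).
Proof.
apply: measurable_funB; first exact: measurable_edge_wind.
apply: measurable_funM; first by apply: measurable_step; exact: measurable_fst_plane.
apply: measurable_funM => //; apply: measurable_funD; apply: measurable_sgr;
  by apply: measurable_funB => //; exact: measurable_snd_plane.
Qed.

Lemma edge_wind_le1 e z : `|edge_wind e z| <= 1.
Proof.
rewrite normrM mulr_ile1 ?step_le1 // /side normrM mulr_ile1 //; exact: sgr_le1.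
Qed.

Lemma mean_sgr_le1 (x y : R) : `|(Num.sg x + Num.sg y) / 2| <= 1.
Proof.
rewrite normrM (ger0_norm (_ : 0 <= 2^-1)) ?invr_ge0 // ler_pdivrMr // mul1r.
by apply: le_trans (ler_normD _ _) _; have := sgr_le1 x; have := sgr_le1 y; lra.
Qed.

Lemma edge_diagonal_le2 e z : `|edge_diagonal e z| <= 2.
Proof.
apply: le_trans (ler_normB _ _) _; have := edge_wind_le1 e z.
suff : `|step e.1.1 e.2.1 z.1 * ((Num.sg (z.2 - e.1.2) + Num.sg (z.2 - e.2.2)) / 2)| <= 1
  by lra.
by rewrite normrM mulr_ile1 ?step_le1 ?mean_sgr_le1.
Qed.

Lemma edge_diagonal_support e z : edge_diagonal e z != 0 ->
  (Num.min e.1.1 e.2.1 <= z.1 <= Num.max e.1.1 e.2.1) /\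
  (Num.min e.1.2 e.2.2 <= z.2 <= Num.max e.1.2 e.2.2).
Proof.
move=> dz; split.
  apply: step_neq0; apply: contraNneq dz => s0.
  by rewrite /edge_diagonal /edge_wind s0 !mul0r subrr.
apply: contraNT dz; rewrite negb_and -!ltNge lt_min gt_max => /orP[] /andP[h1 h2].
  by rewrite /edge_diagonal edge_wind_below // !ltr0_sg ?subr_lt0 //; apply/eqP; field.
by rewrite /edge_diagonal edge_wind_above // !gtr0_sg ?subr_gt0 //; apply/eqP; field.
Qed.

Lemma edge_diagonal_odd e (z : R * R) :
  edge_diagonal e (e.1.1 + e.2.1 - z.1, e.1.2 + e.2.2 - z.2) = - edge_diagonal e z.
Proof.
rewrite /edge_diagonal /edge_wind /side /= step_sym.
have -> : edge_det e (e.1.1 + e.2.1 - z.1, e.1.2 + e.2.2 - z.2) = - edge_det e z.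
  by rewrite /edge_det /=; ring.
have -> : e.1.2 + e.2.2 - z.2 - e.1.2 = - (z.2 - e.2.2) by ring.
have -> : e.1.2 + e.2.2 - z.2 - e.2.2 = - (z.2 - e.1.2) by ring.
by rewrite !sgrN; ring.
Qed.

(** By oddness [g] can be replaced by its difference with its value at the
    centre, which is O(N^-1) on a rectangle of area and mass O(N^-2). *)
Lemma edge_diagonal_estimate g (A : R) : continuously_differentiable 1 g ->
  exists2 L, 0 <= L & forall N (s t p : int) (q : nat), (0 < N)%N ->
    `|node N s| <= A -> `|node N (s + q%:Z)| <= A ->
    `|node N t| <= A -> `|node N (t + p)| <= A ->
    `|defect N (fun z => edge_diagonal ((node N s, node N t), (node N (s + q%:Z), node N (t
      + p))) z * g z)|
      <= L * (q + `|p|)%:R * (q * `|p| + q.+1 * `|p|.+1)%:R / N%:R ^+ 3.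
Proof.
move=> g1; have cg : continuous g by case: g1.
have [L L0 gL] := lipschitz_box A g1.
exists (2 * L) => [|N s t p q N0 s1 s2 t1 t2]; first exact: mulr_ge0.
have NR : 0 < N%:R :> R by rewrite ltr0n.
set e := (_, _); pose c : R * R := ((node N s + node N (s + q%:Z)) / 2, (node N t + node N
  (t + p)) / 2).
have avg (x y : R) : `|x| <= A -> `|y| <= A -> `|(x + y) / 2| <= A.
  by rewrite !ler_norml => /andP[? ?] /andP[? ?]; apply/andP; split; lra.
have c1A : `|c.1| <= A by exact: avg.
have c2A : `|c.2| <= A by exact: avg.
have btw (x y w : R) : Num.min x y <= w <= Num.max x y -> `|x| <= A -> `|y| <= A ->
    `|w| <= A /\ `|w - (x + y) / 2| <= `|y - x|.
  move=> xwy xA yA; split; first by have [] := between_box xA yA xwy.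
  case: (leP x y) xwy => xy /andP[? ?].
    by rewrite [X in _ <= X]ger0_norm ?subr_ge0 // ler_norml; apply/andP; split; lra.
  by rewrite [X in _ <= X]ltr0_norm ?subr_lt0 // ler_norml; apply/andP; split; lra.
have supp z : edge_diagonal e z != 0 -> [/\ `|z.1| <= A, `|z.2| <= A &
    `|z.1 - c.1| + `|z.2 - c.2| <= (q + `|p|)%:R / N%:R].
  move=> /edge_diagonal_support[/btw /(_ s1 s2)[z1 h1] /btw /(_ t1 t2)[z2 h2]]; split => //.
  rewrite natrD mulrDl; apply: lerD.
    apply: le_trans h1 _; rewrite /= nodeD addrAC subrr add0r /node normrM.
    by rewrite (ger0_norm (_ : 0 <= N%:R^-1)) ?invr_ge0 // -pmulrn ger0_norm.
  apply: le_trans h2 _; rewrite /= nodeD addrAC subrr add0r /node normrM.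
  by rewrite (ger0_norm (_ : 0 <= N%:R^-1)) ?invr_ge0 // -intr_norm -natr_absz.
have ad : admissible (edge_diagonal e).
  apply: (@admissible_bounded _ A 2); [exact: measurable_edge_diagonal|exact:
    edge_diagonal_le2|].
  by move=> z /supp[].
pose h z := g z - g c.
have ch : continuous h by move=> z; apply: cvgB; [exact: cg|exact: cvg_cst].
have -> : (fun z => edge_diagonal e z * g z) =
    (fun z => g c * edge_diagonal e z) \+ (fun z => edge_diagonal e z * h z).
  by apply/funext => z /=; rewrite /h; ring.
have ah := admissibleM ad ch.
rewrite defectD //; last exact: admissibleZ.
rewrite defectZ // (@defect_odd _ N _ (s + (s + q%:Z), t + (t + p))) // ?mulr0 ?add0r;
  last first.
  move=> z; rewrite -edge_diagonal_odd; congr (edge_diagonal e _).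
  rewrite /reflection /scaled_point /= /node -!mulrDl -!intrD.
  by rewrite ![N%:R^-1 * _]mulrC.
(* The lower side of the box depends on the direction of the edge. *)
have := @defect_box _ N (fun z => edge_diagonal e z * h z) (2 * (L * ((q + `|p|)%:R / N%:R)))
  s (if 0 <= p then t else t + p) q `|p|%N N0.
have -> : 2 * (L * ((q + `|p|)%:R / N%:R)) * (q * `|p| + q.+1 * `|p|.+1)%:R / N%:R ^+ 2 =
  2 * L * (q + `|p|)%:R * (q * `|p| + q.+1 * `|p|.+1)%:R / N%:R ^+ 3.
  by field; rewrite gt_eqF.
apply.
- exact: admissible_measurable ah.
- move=> z; have [->|dz] := eqVneq (edge_diagonal e z) 0.
    by rewrite mul0r normr0 !mulr_ge0 // invr_ge0.
  have [z1 z2 zc] := supp z dz.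
  rewrite normrM ler_pM ?edge_diagonal_le2 //.
  by apply: le_trans (gL c z c1A c2A z1 z2) _; apply: ler_wpM2l.
- move=> z; rewrite mulf_eq0 negb_or => /andP[/edge_diagonal_support[+ +] _].
  rewrite /= => zs zt; split.
    move: zs; rewrite min_l ?max_r ?node_le ?lerDl //.
    by rewrite /node ler_pdivrMr ?ler_pdivlMr // mulrC.
  case: ifPn zt => p0.
    rewrite gez0_abs // min_l ?max_r ?node_le ?lerDl //.
    by rewrite /node ler_pdivrMr ?ler_pdivlMr // mulrC.
  move: p0; rewrite -ltNge => p0.
  rewrite min_r ?max_l ?node_le ?gerDl ?(ltW p0) // ltz0_abs // addrK.
  by rewrite /node ler_pdivrMr ?ler_pdivlMr // mulrC.
Qed.

End Estimates.
Arguments node {R} N k.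

(** * Trapezoids *)

Section EdgeEstimate.
Variable R : realType.
Implicit Types (u g : R * R -> R) (e : (R * R) * (R * R)) (z : R * R) (N : nat).

Local Notation PT := (measurableTypeR R * measurableTypeR R)%type.
Local Notation plane := ((@lebesgue_measure R) \x (@lebesgue_measure R))%E.

(** For an edge that goes to the right, minus the indicator of the trapezoid
    between height [- M] and the edge, plus that of the trapezoid between the
    edge and height [M]. *)
Definition trapezoid (M : R) e z : R := step e.1.1 e.2.1 z.1 *
  (side e z - (Num.sg (z.2 - M) + Num.sg (z.2 + M)) / 2).

Lemma continuously_differentiableW (k : nat) g :
  continuously_differentiable k.+1 g -> continuously_differentiable k g.
Proof.
elim: k g => [|k IHk] g; first by case.
by case=> cg dg g1 g2; exact: (And4 cg dg (IHk _ g1) (IHk _ g2)).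
Qed.

(** Column [i] lies over the piece [ei i] of the edge, between two lattice
    points, since the edge vector is (q, p) and the piece is its N-th part.  The
    column is the diagonal piece [D i] plus the rectangle [T i] above the piece
    and minus the rectangle [B i] below, which have lattice corners. *)
Lemma edge_estimate_lr g (a1 a2 p : int) (q M : nat) : continuously_differentiable 2 g ->
  (0 < q)%N -> `|a2| <= M%:Z -> `|a2 + p| <= M%:Z ->
  let e : (R * R) * (R * R) := ((a1%:~R, a2%:~R), ((a1 + q%:Z)%:~R, (a2 + p)%:~R)) in
  exists2 K, 0 <= K & forall N, (0 < N)%N ->
    `|defect N (fun z => trapezoid M%:R e z * g z)| <= K / N%:R ^+ 2.
Proof.
move=> g2 q0 a2M b2M e; have g1 := continuously_differentiableW g2.
have cg : continuous g by case: g2.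
pose A : R := (`|a1| + q%:Z + M%:Z)%:~R.
have [K K0 rectK] := rect_estimate A g2.
have [L L0 diagL] := edge_diagonal_estimate A g1.
pose K1 := L * (q + `|p|)%:R * (q * `|p| + q.+1 * `|p|.+1)%:R.
have K10 : 0 <= K1 by rewrite !mulr_ge0.
exists (K1 + 2 * ((q * M.*2)%:R * K)) => [|N N0]; first by rewrite addr_ge0 ?mulr_ge0.
have NR : 0 < N%:R :> R by rewrite ltr0n.
have NR0 : N%:R != 0 :> R by rewrite gt_eqF.
pose s i := a1 * N%:Z + Posz i * q%:Z; pose t i := a2 * N%:Z + Posz i * p.
have sS i : s i.+1 = s i + q%:Z by rewrite /s -addn1 PoszD; ring.
have tS i : t i.+1 = t i + p by rewrite /t -addn1 PoszD; ring.
have s0 : node N (s 0) = a1%:~R :> R by rewrite /s mul0r addr0 /node intrM mulfK.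
have sN : node N (s N) = (a1 + q%:Z)%:~R :> R.
  have -> : s N = (a1 + q%:Z) * N%:Z by rewrite /s; ring.
  by rewrite /node intrM mulfK.
have nodeA (k : int) : `|k| <= (`|a1| + q%:Z + M%:Z) * N%:Z -> `|node N k : R| <= A.
  move=> kA; rewrite /node normrM (ger0_norm (_ : 0 <= N%:R^-1)) ?invr_ge0 //.
  by rewrite ler_pdivrMr // -intr_norm /A -[N%:R]/((N%:Z)%:~R) -intrM ler_int.
have sA i : (i <= N)%N -> `|node N (s i)| <= A.
  move=> iN; apply: nodeA; rewrite /s.
  have h1 : `|a1 * N%:Z| <= `|a1| * N%:Z by rewrite normrM.
  have h2 : `|Posz i * q%:Z| <= N%:Z * q%:Z by rewrite normrM ler_wpM2r.
  apply: le_trans (ler_normD _ _) _.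
  by have : 0 <= M%:Z * N%:Z by []; lia.
have tM i : (i <= N)%N -> `|t i| <= M%:Z * N%:Z.
  move=> iN; have -> : t i = a2 * (N - i)%:Z + (a2 + p) * i%:Z.
    by rewrite /t -subzn //; ring.
  apply: le_trans (ler_normD _ _) _; rewrite !normrM.
  have h1 : `|a2| * `|(N - i)%:Z| <= M%:Z * (N - i)%:Z by apply: ler_wpM2r.
  have h2 : `|a2 + p| * `|i%:Z| <= M%:Z * i%:Z by apply: ler_wpM2r.
  apply: le_trans (lerD h1 h2) _.
  by rewrite -mulrDr -PoszD subnK.
have tA i : (i <= N)%N -> `|node N (t i)| <= A.
  move=> /tM tiM; apply: nodeA; apply: le_trans tiM _.
  by apply: ler_wpM2r => //; rewrite lerDr addr_ge0.
have MA : `|node N (M%:Z * N%:Z)| <= A /\ `|node N (- (M%:Z * N%:Z))| <= A.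
  have h : `|M%:Z * N%:Z| <= (`|a1| + q%:Z + M%:Z) * N%:Z.
    by rewrite normrM; apply: ler_wpM2r => //; rewrite ger0_norm // lerDr addr_ge0.
  by split; apply: nodeA; rewrite ?normrN.
have nodeM : node N (M%:Z * N%:Z) = M%:R :> R by rewrite /node intrM mulfK.
have nodeNM : node N (- (M%:Z * N%:Z)) = - M%:R :> R by rewrite /node mulrNz mulNr intrM mulfK.
pose ei i : (R * R) * (R * R) := ((node N (s i), node N (t i)), (node N (s i + q%:Z), node
  N (t i + p))).
pose m i := absz (M%:Z * N%:Z - t i)%R.
pose n i := absz (t i + p + M%:Z * N%:Z)%R.
have mE i : (i <= N)%N -> t i + (m i)%:Z = M%:Z * N%:Z.
  by move=> /tM; rewrite /m ler_norml => /andP[? ?]; rewrite gez0_abs; lia.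
have nE i : (i < N)%N -> - (M%:Z * N%:Z) + (n i)%:Z = t i + p.
  by move=> /tM; rewrite tS /n ler_norml => /andP[? ?]; rewrite gez0_abs; lia.
have mle i : (i <= N)%N -> (m i <= M.*2 * N)%N.
  move=> iN; have := mE i iN; have := tM i iN; rewrite ler_norml -lez_nat PoszM -addnn PoszD.
  by move=> /andP[? ?]; lia.
have nle i : (i < N)%N -> (n i <= M.*2 * N)%N.
  move=> iN; have := nE i iN; have := tM i.+1 iN;
    rewrite tS ler_norml -lez_nat PoszM -addnn PoszD.
  by move=> /andP[? ?]; lia.
pose D i z := edge_diagonal (ei i) z * g z.
pose T i z := rect (node N (s i)) (node N (s i + q%:Z)) (node N (t i)) (node N (t i + (m
  i)%:Z)) z * g z.
pose B i z := rect (node N (s i)) (node N (s i + q%:Z)) (node N (- (M%:Z * N%:Z))) (node N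
  (- (M%:Z * N%:Z) + (n i)%:Z)) z * g z.
have sideE i z : side (ei i) z = side e z.
  rewrite /side; have -> : edge_det (ei i) z = N%:R^-1 * edge_det e z.
    by rewrite /edge_det /= /node /s /t !intrD !intrM; field.
  have -> : (ei i).2.1 - (ei i).1.1 = N%:R^-1 * (e.2.1 - e.1.1).
    by rewrite /= /node !intrD; field.
  by rewrite !sgrM gtr0_sg ?invr_gt0 // !mul1r.
have trapE : (fun z => trapezoid M%:R e z * g z) =
    (fun z => \sum_(i < N) (D i z + (T i z + -1 * B i z))).
  apply/funext => z; rewrite /trapezoid.
  have -> : step e.1.1 e.2.1 z.1 = \sum_(i < N) step (node N (s i)) (node N (s i.+1)) z.1.
    by rewrite (sum_step (fun i => node N (s i))) s0 sN.
  rewrite !mulr_suml.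
  apply: eq_bigr => i _; have iN := ltn_ord i.
  rewrite /D /T /B mE ?(ltnW iN) // nE // nodeM nodeNM sS /edge_diagonal /edge_wind sideE /=.
  by rewrite /rect /step opprK; field.
have aT i : admissible (T i) by apply: admissibleM => //; exact: admissible_rect.
have aB i : admissible (B i) by apply: admissibleM => //; exact: admissible_rect.
have adiag (f : (R * R) * (R * R)) : admissible (edge_diagonal f).
  pose bd := `|f.1.1| + `|f.2.1| + `|f.1.2| + `|f.2.2|.
  apply: (@admissible_bounded _ _ bd 2); [exact: measurable_edge_diagonal|exact:
    edge_diagonal_le2|].
  have mm (x y w : R) (xyw : Num.min x y <= w <= Num.max x y) : `|w| <= `|x| + `|y|.
    have xB : `|x| <= `|x| + `|y| by rewrite lerDl.
    have yB : `|y| <= `|x| + `|y| by rewrite lerDr.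
    by have [] := between_box xB yB xyw.
  move=> z /edge_diagonal_support[h1 h2]; rewrite /bd; have := mm _ _ _ h1; have := mm _ _ _ h2.
  have ? := normr_ge0 f.1.1; have ? := normr_ge0 f.2.1.
  have ? := normr_ge0 f.1.2; have ? := normr_ge0 f.2.2.
  by move=> ? ?; split; lra.
have aD i : admissible (D i) by apply: admissibleM.
rewrite trapE (defect_sum _ N0) => [|i]; last first.
  by apply: admissibleD => //; apply: admissibleD => //; exact: admissibleZ.
apply: le_trans (ler_norm_sum _ _ _) _.
(* The cost of one column: a diagonal piece and two rectangles of at most
   [q * (2 * M * N)] cells. *)
pose C := (K1 + 2 * ((q * M.*2)%:R * K)) / N%:R ^+ 3.
apply: (@le_trans _ _ (\sum_(i < N) C)); last first.
  rewrite sumr_const card_ord -mulr_natl /C le_eqVlt; apply/orP; left; apply/eqP.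
  by field.
apply: ler_sum => i _; have iN := ltn_ord i; have iN' := ltnW iN.
rewrite defectD //; last by apply: admissibleD => //; exact: admissibleZ.
rewrite defectD //; last exact: admissibleZ.
rewrite defectZ // mulN1r.
have bndA x : `|x| <= A -> - A <= x /\ x <= A by rewrite ler_norml => /andP[].
have hD : `|defect N (D i)| <= K1 / N%:R ^+ 3.
  by apply: diagL => //; rewrite -?sS -?tS ?sA ?tA.
have rK (k : nat) : (k <= M.*2 * N)%N -> (q * k)%:R * (K / N%:R ^+ 4) <= (q * M.*2)%:R * K
  / N%:R ^+ 3.
  move=> kM; have -> : (q * M.*2)%:R * K / N%:R ^+ 3 = (q * (M.*2 * N))%:R * (K / N%:R ^+ 4).
    by rewrite !natrM; field.
  apply: ler_wpM2r; first by rewrite mulr_ge0 // invr_ge0 exprn_ge0 // ltW.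
  by rewrite ler_nat leq_mul2l kM orbT.
have hT : `|defect N (T i)| <= (q * M.*2)%:R * K / N%:R ^+ 3.
  apply: le_trans (rK _ (mle i iN')); apply: rectK => //.
  - by have [] := bndA _ (sA i iN').
  - by rewrite -sS; have [] := bndA _ (sA i.+1 iN).
  - by have [] := bndA _ (tA i iN').
  - by rewrite mE //; have [_] := bndA _ MA.1.
have hB : `|defect N (B i)| <= (q * M.*2)%:R * K / N%:R ^+ 3.
  apply: le_trans (rK _ (nle i iN)); apply: rectK => //.
  - by have [] := bndA _ (sA i iN').
  - by rewrite -sS; have [] := bndA _ (sA i.+1 iN).
  - by have [] := bndA _ MA.2.
  - by rewrite nE // -tS; have [_] := bndA _ (tA i.+1 iN).
have -> : C = K1 / N%:R ^+ 3 + ((q * M.*2)%:R * K / N%:R ^+ 3 + (q * M.*2)%:R * K / N%:R ^+ 3).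
  by rewrite /C; field.
apply: le_trans (ler_normD _ _) _; apply: lerD hD _.
by apply: le_trans (ler_normB _ _) _; exact: lerD.
Qed.

End EdgeEstimate.

(** * Summation over the edges *)

Section Assembly.
Variable R : realType.
Implicit Types (u g : R * R -> R) (e : (R * R) * (R * R)) (z v : R * R) (N : nat).

Local Notation PT := (measurableTypeR R * measurableTypeR R)%type.
Local Notation plane := ((@lebesgue_measure R) \x (@lebesgue_measure R))%E.

Lemma trapezoidE M e z : trapezoid M e z = edge_wind e z -
  step e.1.1 e.2.1 z.1 * ((Num.sg (z.2 - M) + Num.sg (z.2 + M)) / 2).
Proof. by rewrite /trapezoid /edge_wind mulrBr. Qed.

Lemma trapezoid_rev M e z : trapezoid M (e.2, e.1) z = - trapezoid M e z.
Proof.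
rewrite /trapezoid /= stepC mulNr; congr (- (_ * (_ - _))); rewrite /side /=.
have -> : edge_det (e.2, e.1) z = - edge_det e z by rewrite /edge_det /=; ring.
by rewrite -opprB !sgrN mulrNN.
Qed.

(** Above and below all the levels in play, the cut-off cancels the edge. *)
Lemma admissible_trapezoid (M : R) e : `|e.1.2| <= M -> `|e.2.2| <= M ->
  admissible (trapezoid M e).
Proof.
move=> e1 e2; apply: (@admissible_bounded _ _ (`|e.1.1| + `|e.2.1| + M) 2).
- apply: measurable_funM; first by apply: measurable_step; exact: measurable_fst_plane.
  apply: measurable_funB.
    apply: measurable_funM => //; apply: measurable_sgr.
    by apply: continuous_plane_measurable; exact: continuous_edge_det.
  apply: measurable_funM => //; apply: measurable_funD; apply: measurable_sgr.
    by apply: measurable_funB => //; exact: measurable_snd_plane.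
  by apply: measurable_funD => //; exact: measurable_snd_plane.
- move=> z; rewrite trapezoidE; apply: le_trans (ler_normB _ _) _.
  have := edge_wind_le1 e z.
  suff : `|step e.1.1 e.2.1 z.1 * ((Num.sg (z.2 - M) + Num.sg (z.2 + M)) / 2)| <= 1 by lra.
  by rewrite normrM mulr_ile1 ?step_le1 ?mean_sgr_le1.
- move=> z tz; have M0 : 0 <= M by apply: le_trans e1.
  have /andP[a1 a2] : - M <= e.1.2 <= M by rewrite -ler_norml.
  have /andP[b1 b2] : - M <= e.2.2 <= M by rewrite -ler_norml.
  have e11 := normr_ge0 e.1.1; have e21 := normr_ge0 e.2.1; split.
    have /step_neq0 xz : step e.1.1 e.2.1 z.1 != 0.
      by apply: contraNneq tz; rewrite /trapezoid => ->; rewrite mul0r.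
    have xB : `|e.1.1| <= `|e.1.1| + `|e.2.1| by rewrite lerDl.
    have yB : `|e.2.1| <= `|e.1.1| + `|e.2.1| by rewrite lerDr.
    by have [? _] := between_box xB yB xz; lra.
  suff : `|z.2| <= M by lra.
  rewrite leNgt; apply: contraNN tz; rewrite ltr_normr => /orP zM.
  rewrite trapezoidE; case: zM => zM.
    rewrite edge_wind_above; [|lra..].
    by rewrite !gtr0_sg; [apply/eqP; field|lra..].
  rewrite edge_wind_below; [|lra..].
  by rewrite !ltr0_sg; [apply/eqP; field|lra..].
Qed.

(** Reversing an edge changes the sign of its trapezoid, so the edge may be
    assumed to go to the right; vertical edges contribute nothing. *)
Lemma edge_estimate g e (M : nat) : continuously_differentiable 2 g ->
  integer_point e.1 -> integer_point e.2 -> `|e.1.2| <= M%:R -> `|e.2.2| <= M%:R ->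
  exists K, forall N, (0 < N)%N ->
    `|defect N (fun z => trapezoid M%:R e z * g z)| <= K / N%:R ^+ 2.
Proof.
move=> g2; have cg : continuous g by case: g2.
wlog : e / e.1.1 <= e.2.1.
  move=> H; have [le12|/ltW le21] := leP e.1.1 e.2.1; first exact: H.
  move=> i1 i2 M1 M2; have [K KP] := H (e.2, e.1) le21 i2 i1 M2 M1.
  exists K => N N0; have := KP N N0; rewrite /=.
  have -> : (fun z => trapezoid M%:R (e.2, e.1) z * g z) = (fun z => -1 * (trapezoid M%:R e
    z * g z)).
    by apply/funext => z; rewrite trapezoid_rev; ring.
  rewrite defectZ ?mulN1r ?normrN //.
  by apply: admissibleM => //; exact: admissible_trapezoid.
case: e => [[x1 y1] [x2 y2]] /= le12 [/intrP[a1 E1] /intrP[a2 E2]] [/intrP[b1 E3] /intrP[b2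
  E4]] M1 M2.
rewrite /= in E1 E2 E3 E4.
move: le12 M1 M2; rewrite {}E1 {}E2 {}E3 {}E4 /= => le12 M1 M2.
have [E|ne] := eqVneq a1 b1.
  exists 0 => N N0; rewrite mul0r (_ : (fun z => _) = (fun=> 0)) ?defect0 ?normr0 //.
  by apply/funext => z; rewrite /trapezoid E /step subrr !mul0r.
have ltab : a1 < b1 by rewrite lt_neqAle ne -(ler_int R).
have := @edge_estimate_lr R g a1 a2 (b2 - a2) (absz (b1 - a1)%R) M g2.
have b1E : a1 + (absz (b1 - a1)%R)%:Z = b1 by rewrite gez0_abs ?subr_ge0 ?ltW // addrC subrK.
have b2E : a2 + (b2 - a2) = b2 by rewrite addrC subrK.
rewrite b1E b2E => /(_ _ _ _)[].
- by rewrite absz_gt0 subr_eq0 eq_sym.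
- by rewrite -(ler_int R) intr_norm.
- by rewrite -(ler_int R) intr_norm.
- by move=> K _ KP; exists K.
Qed.

Lemma measurable_point v : measurable_fun [set: PT] (fun z : PT => (z == v :> R * R)%:R : R).
Proof.
have -> : (fun z : PT => (z == v :> R * R)%:R) = (\1_([set v] : set PT) : PT -> R).
  apply/funext => z; rewrite indicE; congr (nat_of_bool _)%:R.
  by apply/eqP/idP; rewrite inE.
apply: measurable_indic.
have -> : ([set v] : set PT) = [set v.1]%classic `*` [set v.2]%classic.
  apply/seteqP; split => z /=; first by move=> ->.
  by move=> [z1 z2]; rewrite [z]surjective_pairing [v]surjective_pairing z1 z2.
by apply: measurableX; exact: measurable_set1.
Qed.

(** An integral point is a lattice point for every [N]. *)
Lemma defect_point N v : (0 < N)%N -> integer_point v ->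
  `|defect N (fun z => (z == v)%:R)| <= 1 / N%:R ^+ 2.
Proof.
move=> N0 [/intrP[k E1] /intrP[l E2]].
have := @defect_box _ N (fun z : R * R => (z == v)%:R) 1 (k * N%:Z) (l * N%:Z) 0 0 N0.
rewrite mul0n add0n mul1n mulr1; apply.
- exact: measurable_point.
- by move=> z; case: (z == v); rewrite ?normr1 ?normr0.
- move=> z; rewrite pnatr_eq0 eqb0 negbK => /eqP ->.
  by rewrite !addr0 E1 E2 !intrM ![_ * N%:R]mulrC !lexx.
Qed.

Section Main.
Variables (P : set (R * R)) (cs : seq (seq (R * R))) (g : R * R -> R).
Hypothesis polyP : open_polygon cs P.
Hypothesis integer_cs : forall c v, c \in cs -> v \in c -> integer_point v.
Hypothesis g2 : continuously_differentiable 2 g.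
Let es := edges cs.

Let cg : continuous g. Proof. by case: g2. Qed.
Let oP : open P. Proof. by case: polyP => _ []. Qed.

Lemma edge_integer e : e \in es -> integer_point e.1 /\ integer_point e.2.
Proof.
move=> /flattenP[_ /mapP[c ccs ->]]; rewrite /chain_edges => ec.
have sub (s r : seq (R * R)) : e \in zip s r -> e.1 \in s /\ e.2 \in r.
  elim: s r => [|x s IHs] [|y r] //=; rewrite inE => /predU1P[->|/IHs[h1 h2]].
    by rewrite !mem_head.
  by rewrite !inE h1 h2 !orbT.
have [h1 h2] := sub _ _ ec; rewrite mem_rot in h2.
by split; [exact: integer_cs h1|exact: integer_cs h2].
Qed.

Lemma measurable_frontier : measurable (frontier P : set PT).
Proof.
apply: measurableD; last by apply: open_plane_measurable; exact: open_interior.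
rewrite -[closure P]setCK; apply: measurableC; apply: open_plane_measurable.
by apply: closed_openC; exact: closed_closure.
Qed.

Lemma admissible_indic (A : set PT) : measurable A -> A `<=` P `|` frontier P ->
  admissible (\1_A : R * R -> R).
Proof.
move=> mA AP; have [B BP] := region_bounded polyP.
apply: (@admissible_bounded _ _ B 1).
- exact: measurable_indic.
- by move=> z; rewrite indicE; case: (_ \in _); rewrite ?normr1 ?normr0.
- move=> z; rewrite indicE pnatr_eq0 eqb0 negbK inE => /AP zP.
  have [h1 h2] : `|z.1| < B /\ `|z.2| < B by apply: BP; case: zP => ?; [left|right; left].
  by split; exact: ltW.
Qed.

Let aP : admissible (\1_P : R * R -> R).
Proof. by apply: admissible_indic; [exact: open_plane_measurable|move=> z; left]. Qed.

Let aF : admissible (\1_(frontier P) : R * R -> R).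
Proof. by apply: admissible_indic; [exact: measurable_frontier|move=> z; right]. Qed.

Lemma half_weightE z : half_weight P z = \1_P z + 2^-1 * \1_(frontier P) z.
Proof. by rewrite /half_weight mulrC. Qed.

Lemma admissible_half_weight : admissible (half_weight P).
Proof.
have -> : half_weight P = (\1_P : _ -> R) \+ (fun z => 2^-1 * \1_(frontier P) z).
  by apply/funext => z; rewrite half_weightE.
by apply: admissibleD => //; exact: admissibleZ.
Qed.

Lemma Rintegral_half_weight :
  \int[plane]_(z in P) g z = \int[plane]_z (half_weight P z * g z).
Proof.
rewrite Rintegral_mkcond.
have -> : g \_ P = fun z => \1_P z * g z.
  by apply/funext => z; rewrite patchE indicE; case: ifP; rewrite ?mul1r ?mul0r.
apply: (Rintegral_null (s := [seq (- (e.2.2 - e.1.2), e.2.1 - e.1.1,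
    (e.2.1 - e.1.1) * e.1.2 - (e.2.2 - e.1.2) * e.1.1) | e <- es])).
- exact: admissibleM.
- exact: admissibleM admissible_half_weight cg.
- move=> _ /mapP[e ees ->] /=; rewrite oppr_eq0 !subr_eq0.
  have e12 : e.1 != e.2 by case: polyP => -[_ h _] _; exact: h.
  rewrite -negb_and; apply: contraNN e12 => /andP[/eqP h2 /eqP h1].
  by rewrite [e.1]surjective_pairing [e.2]surjective_pairing h1 h2.
- move=> z; rewrite half_weightE => zP.
  have [Fz|nFz] := pselect (frontier P z); last first.
    have F0 : \1_(frontier P) z = 0 :> R by rewrite indicE memNset.
    by move: zP; rewrite F0 mulr0 addr0 eqxx.
  have frontierE : frontier P = \bigcup_(e in [set` es]) plane_segment e by case: polyP => _ [].
  move: Fz; rewrite frontierE => -[e /= ees].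
  have e12 : e.1 != e.2 by case: polyP => -[_ h _] _; exact: h.
  move=> /(plane_segmentP _ e12)[dz _]; eexists; first by apply/mapP; exists e.
  by move: dz; rewrite /line_set /edge_det /=; lra.
Qed.

Lemma lattice_sum_half_weight N : (0 < N)%N ->
  lattice_sum N (fun z => half_weight P z * g z) =
  \sum_(n \in [set n : int * int | P (scaled_point N n)]) g (scaled_point N n) +
  2^-1 * \sum_(n \in [set n : int * int | frontier P (scaled_point N n)]) g (scaled_point N n).
Proof.
move=> N0.
have -> : (fun z => half_weight P z * g z) =
   (fun z => \1_P z * g z) \+ (fun z => 2^-1 * (\1_(frontier P) z * g z)).
  by apply/funext => z; rewrite half_weightE /=; ring.
have aPg := admissibleM aP cg; have aFg := admissibleM aF cg.
rewrite lattice_sumD //; last exact: admissibleZ.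
have sumE (A : set (R * R)) : lattice_sum N (fun z => \1_A z * g z) =
    \sum_(n \in [set n : int * int | A (scaled_point N n)]) g (scaled_point N n).
  rewrite [RHS]fsbig_mkcond; apply: eq_fsbigr => n _; rewrite patchE indicE.
  have -> : (n \in [set n : int * int | A (scaled_point N n)]) = (scaled_point N n \in A).
    by apply/idP/idP; rewrite !inE.
  by case: ifP; rewrite ?mul1r ?mul0r.
by rewrite (sumE P) -(sumE (frontier P)) [X in _ = _ + X]mulr_fsumr.
Qed.

(** The decomposition of the weight holds off the vertices; the error [d] that
    remains at the vertices does not depend on [N]. *)
Lemma defect_half_weight : exists C, forall N, (0 < N)%N ->
  `|defect N (fun z => half_weight P z * g z)| <= C / N%:R ^+ 2.
Proof.
have [c cP] := half_weight_decomposition polyP.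
have [B BP] := region_bounded polyP.
pose M := (Num.truncn `|B|).+1.
have BM v : v \in vertices es -> `|v.2| <= M%:R.
  move=> vv; have [_ h] := BP v (or_intror (or_intror vv)).
  by apply: le_trans (ltW h) _; apply: le_trans (ler_norm B) _; exact: ltW (truncnS_gt _).
have iv v : v \in vertices es -> integer_point v.
  move=> /flattenP[_ /mapP[e ees ->]]; have [h1 h2] := edge_integer ees.
  by rewrite !inE => /orP[] /eqP ->.
have /choice[K KP] : forall e, exists K, e \in es -> forall N, (0 < N)%N ->
    `|defect N (fun z => trapezoid M%:R e z * g z)| <= K / N%:R ^+ 2.
  move=> e.
  have [ees|nes] := boolP (e \in es); last by exists 0.
  have [h1 h2] := edge_integer ees.
  have [/BM M1 /BM M2] := mem_vertices ees.
  have [K KP] := edge_estimate g2 h1 h2 M1 M2.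
  by exists K.
(* The default value 0 makes [trap e] admissible for all [e]. *)
pose trap e z := (if e \in es then trapezoid M%:R e z else 0) * g z.
have atrap e : admissible (trap e).
  rewrite /trap; case: (boolP (e \in es)) => ees; apply: admissibleM => //.
    by have [/BM M1 /BM M2] := mem_vertices ees; exact: admissible_trapezoid.
  exact: admissible0.
pose d z := half_weight P z * g z - \sum_(e <- es) c e * trap e z.
have d0 z : z \notin vertices es -> d z = 0.
  move=> zv; rewrite /d (cP M%:R z zv) mulr_suml -sumrB big1_seq // => e /andP[_ ees].
  by rewrite /trap ees /trapezoid; ring.
pose V := undup (vertices es).
have decomp : (fun z => half_weight P z * g z) =
    (fun z => \sum_(e <- es) c e * trap e z) \+ (fun z => \sum_(v <- V) d v * (z == v)%:R).
  apply/funext => z /=; have -> : \sum_(v <- V) d v * (z == v)%:R = d z.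
    have [zV|zV] := boolP (z \in V).
      rewrite (bigD1_seq z) ?undup_uniq //= eqxx mulr1 big1 ?addr0 // => v.
      by rewrite eq_sym => /negbTE ->; rewrite mulr0.
    rewrite d0 -1?mem_undup // big1_seq // => v /andP[_ vV].
    by have [zv|_] := eqVneq z v; [rewrite zv vV in zV|rewrite mulr0].
  by rewrite /d addrC subrK.
have apt v : admissible (fun z => (z == v)%:R : R).
  apply: (@admissible_bounded _ _ (`|v.1| + `|v.2|) 1).
  - exact: measurable_point.
  - by move=> z; case: (z == v); rewrite ?normr1 ?normr0.
  - by move=> z; rewrite pnatr_eq0 eqb0 negbK => /eqP ->; rewrite lerDl lerDr.
exists (\sum_(e <- es) `|c e| * K e + \sum_(v <- V) `|d v|) => N N0.
rewrite decomp defectD //; last 2 first.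
- by apply: admissible_sum => e; exact: admissibleZ.
- by apply: admissible_sum => v; exact: admissibleZ.
rewrite (defect_sum _ N0) => [|e]; last exact: admissibleZ.
rewrite (defect_sum _ N0) => [|v]; last exact: admissibleZ.
apply: le_trans (ler_normD _ _) _; rewrite mulrDl; apply: lerD.
  apply: le_trans (ler_norm_sum _ _ _) _; rewrite mulr_suml big_seq [leRHS]big_seq.
  apply: ler_sum => e ees; rewrite defectZ // normrM -mulrA.
  by apply: ler_wpM2l => //; rewrite /trap ees; exact: KP.
apply: le_trans (ler_norm_sum _ _ _) _; rewrite mulr_suml big_seq [leRHS]big_seq.
apply: ler_sum => v; rewrite mem_undup => vv; rewrite defectZ // normrM.
apply: ler_wpM2l => //; rewrite -div1r; apply: defect_point => //; exact: iv.
Qed.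

End Main.
End Assembly.

Theorem corollary10 (R : realType) (P : set (R * R)) (g : R * R -> R)
    (P_polygon : open_integer_polygon P) (g_smooth : smooth g) :
  exists C : R, forall N : nat, (0 < N)%N ->
    `| \int[((@lebesgue_measure R) \x (@lebesgue_measure R))%E]_(x in P) g x -
       (1 / N%:R ^+ 2 *
          (\sum_(n \in [set n : int * int | P (scaled_point N n)])
              g (scaled_point N n)) +
        1 / (2 * N%:R ^+ 2) *
          (\sum_(n \in [set n : int * int | frontier P (scaled_point N n)])
              g (scaled_point N n))) |
    <= C / N%:R ^+ 2.
Proof.
have [cs [polyP integer_cs]] := P_polygon.
have g2 := g_smooth 2%N.
have [C CP] := defect_half_weight polyP integer_cs g2.
exists C => N N0; have := CP N N0.
have NR : N%:R != 0 :> R by rewrite pnatr_eq0 -lt0n.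
rewrite /defect (lattice_sum_half_weight polyP g2 N0) (Rintegral_half_weight polyP g2).
congr (`|_ - _| <= _); field.
exact: NR.
Qed.
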